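(* Let $(R,\mathfrak{m})$ be a complete local-filtered ring with finite residue field, let $M$ be a permissible $R$-space, and set $q:=|R/\mathfrak{m}|$ and $\delta:=\dim(M)$. Choose a permissible filtration $(F^i(M))_{i\ge0}$ on $M$, and let $\alpha\in\mathbb{Q}$ be the leading coefficient of the Hilbert--Samuel polynomial of $(F^i(M))_{i\ge 0}$. Then $$\lim_{n\to\infty}\frac{\log_q\left|M/\mathfrak{m}^nM\right|}{n^\delta}=\alpha .$$ Consequently, the Hilbert--Samuel polynomial of any permissible filtration on $M$ is of the form $\alpha x^\delta+\text{(lower degree terms)}$.
   Context: Rings are unital and not necessarily associative; ''commutative ring/algebra'' means commutative and associative. An $R$-space is an abelian group $M$ with a bilinear pairing $R\times M\to M$, $(r,m)\mapsto rm$, such that $1m=m$ for all $m\in M$ (no associativity is required). For subsets $A\subseteq R$ and $\Delta\subseteq M$, $A\Delta$ denotes the additive subgroup of all finite sums $\sum ax$ with $a\in A$, $x\in\Delta$ (and similarly for products of subsets of $R$). A filtered ring is a ring $R$ with a decreasing sequence of (two-sided) ideals $F^0(R)\supseteq F^1(R)\supseteq\cdots$ with $F^0(R)=R$ and $F^i(R)F^j(R)\subseteq F^{i+j}(R)$ for all $i,j\ge0$. A filtration on an $R$-space $M$ is a decreasing sequence of $R$-subspaces $F^0(M)\supseteq F^1(M)\supseteq\cdots$ with $F^0(M)=M$ and $F^i(R)F^j(M)\subseteq F^{i+j}(M)$ for all $i,j\ge0$; it is separated if $\bigcap_iF^i(M)=0$. $\mathrm{gr}(R)=\bigoplus_{i\ge0}F^i(R)/F^{i+1}(R)$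 is a graded ring and $\mathrm{gr}(M)=\bigoplus_{i\ge0}F^i(M)/F^{i+1}(M)$ is a graded $\mathrm{gr}(R)$-space. A complete local-filtered ring is a filtered ring $R$ whose filtration is complete (i.e. $R\to\varprojlim R/F^i(R)$ is an isomorphism) and such that $R/F^1(R)$ (the residue field) is a field and $\mathrm{gr}(R)$ is a finitely generated commutative $R/F^1(R)$-algebra, generated in degree $1$. Such a ring is local with maximal ideal $\mathfrak{m}=F^1(R)$, and $F^i(R)F^j(R)=F^{i+j}(R)$ for all $i,j$; one writes $\mathfrak{m}^n:=F^n(R)$ (equal to every bracketing of the $n$-fold product of $\mathfrak{m}$, with $\mathfrak{m}^0=R$). A filtration on an $R$-space $M$ is permissible if it is separated and $\mathrm{gr}(M)$ is a finitely generated $\mathrm{gr}(R)$-module (in the usual associative sense). A permissible $R$-space is an $R$-space with a permissible filtration; $\dim(M)$ is the Krull dimension of the $\mathrm{gr}(R)$-module $\mathrm{gr}(M)$ (it is independent of the choice of permissible filtration). The Hilbert--Samuel polynomial of a permissible filtration $(F^i(M))$ is the polynomial $\mathcal{P}(x)\in\mathbb{Q}[x]$ with $\mathcal{P}(n)=\sum_{k=1}^n\dim_{R/\mathfrak{m}}F^{k-1}(M)/F^k(M)$ for all sufficiently large $n$; its degree is $\dim(M)$. *)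

(* Defs.v *)
From HB Require Import structures.
From mathcomp Require Import all_boot all_order all_algebra finmap.
From mathcomp Require Import all_classical.

Set Implicit Arguments.
Unset Strict Implicit.
Unset Printing Implicit Defensive.

Import Order.TTheory GRing.Theory Num.Theory.

Local Open Scope ring_scope.
Local Open Scope quotient_scope.
Local Open Scope classical_set_scope.

Local Notation "{ 'quot' I }" := (Quotient.quot I) : type_scope.

HB.mixin Record Zmodule_isNARing R of GRing.Zmodule R := {
  naone : R;
  namul : R -> R -> R;
  namulDl : forall x y z, namul (x + y) z = namul x z + namul y z;
  namulDr : forall x y z, namul x (y + z) = namul x y + namul x z;
  namul1l : forall x, namul naone x = x;
  namul1r : forall x, namul x naone = x }.

#[short(type="naRingType")]
HB.structure Definition NARing := {R of Zmodule_isNARing R & GRing.Zmodule R}.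

Notation "x ** y" := (namul x y) (at level 40, left associativity) : ring_scope.

HB.mixin Record Zmodule_isNASpace (R : naRingType) M of GRing.Zmodule M := {
  naact : R -> M -> M;
  naactDl : forall a b x, naact (a + b) x = naact a x + naact b x;
  naactDr : forall a x y, naact a (x + y) = naact a x + naact a y;
  naact1 : forall x, naact naone x = x }.

#[short(type="naSpaceType")]
HB.structure Definition NASpace (R : naRingType) :=
  {M of Zmodule_isNASpace R M & GRing.Zmodule M}.

Notation "a **: x" := (naact a x) (at level 40) : ring_scope.

(** Additive subgroups are the library's [zmodClosed V], boolean predicates;
    by classical logic this is no restriction. *)
Section Subgroup.
Variables (V : zmodType) (A : set V).
Hypotheses (A0 : A 0) (AB : forall x y, A x -> A y -> A (x - y)).

Fact subgroup_zmod_closed : zmod_closed (fun x => `[< A x >]).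
Proof.
by split=> [|x y /asboolP Ax /asboolP Ay]; apply/asboolP; [|exact: AB].
Qed.

Definition subgroup : zmodClosed V :=
  HB.pack (fun x => `[< A x >])
    (GRing.isZmodClosed.Build V (fun x => `[< A x >]) subgroup_zmod_closed).

Lemma subgroupP x : reflect (A x) (x \in subgroup).
Proof. exact: asboolP. Qed.

End Subgroup.

Section Biadditive.
Variables (U V W : zmodType) (b : U -> V -> W).
Hypothesis bDl : forall x y z, b (x + y) z = b x z + b y z.
Hypothesis bDr : forall x y z, b x (y + z) = b x y + b x z.

Lemma biadd0l y : b 0 y = 0.
Proof. by apply: (addrI (b 0 y)); rewrite -bDl !addr0. Qed.

Lemma biadd0r x : b x 0 = 0.
Proof. by apply: (addrI (b x 0)); rewrite -bDr !addr0. Qed.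

Lemma biaddNl x y : b (- x) y = - b x y.
Proof. by apply: (addrI (b x y)); rewrite -bDl !subrr biadd0l. Qed.

Lemma biaddNr x y : b x (- y) = - b x y.
Proof. by apply: (addrI (b x y)); rewrite -bDr !subrr biadd0r. Qed.

Definition conv (x : nat -> U) (y : nat -> V) : nat -> W :=
  fun n => \sum_(i < n.+1) b (x i) (y (n - i)%N).

Lemma convDl x y z : conv (x + y) z = conv x z + conv y z.
Proof.
apply/funext => n; rewrite /conv.
transitivity (\sum_(i < n.+1) (b (x i) (z (n - i)%N) + b (y i) (z (n - i)%N))).
  by apply: eq_bigr => i _; rewrite -bDl.
by rewrite big_split.
Qed.

Lemma convDr x y z : conv x (y + z) = conv x y + conv x z.
Proof.
apply/funext => n; rewrite /conv.
transitivity (\sum_(i < n.+1) (b (x i) (y (n - i)%N) + b (x i) (z (n - i)%N))).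
  by apply: eq_bigr => i _; rewrite -bDr.
by rewrite big_split.
Qed.

Variables (A : zmodClosed U) (B : zmodClosed V) (C : zmodClosed W).

Definition quot_op (x : {quot A}) (y : {quot B}) : {quot C} :=
  \pi_({quot C}) (b (repr x) (repr y)).

Hypothesis bA : forall x y, x \in A -> b x y \in C.
Hypothesis bB : forall x y, y \in B -> b x y \in C.

Lemma quot_opE x y :
  quot_op (\pi_({quot A}) x) (\pi_({quot B}) y) = \pi_({quot C}) (b x y).
Proof.
have hx : repr (\pi_({quot A}) x) - x \in A by rewrite Quotient.idealrBE reprK.
have hy : repr (\pi_({quot B}) y) - y \in B by rewrite Quotient.idealrBE reprK.
apply/eqP; rewrite /quot_op -Quotient.idealrBE.
have -> : b (repr (\pi_({quot A}) x)) (repr (\pi_({quot B}) y)) - b x y =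
    b (repr (\pi_({quot A}) x) - x) (repr (\pi_({quot B}) y)) +
    b x (repr (\pi_({quot B}) y) - y).
  by rewrite bDl bDr biaddNl biaddNr addrA addrNK.
by rewrite rpredD //; [exact: bA | exact: bB].
Qed.

Lemma quot_opDl x y z : quot_op (x + y) z = quot_op x z + quot_op y z.
Proof.
rewrite -[x]reprK -[y]reprK -[z]reprK -raddfD !quot_opE -raddfD.
by rewrite bDl.
Qed.

Lemma quot_opDr x y z : quot_op x (y + z) = quot_op x y + quot_op x z.
Proof.
rewrite -[x]reprK -[y]reprK -[z]reprK -raddfD !quot_opE -raddfD.
by rewrite bDr.
Qed.

End Biadditive.

Record zsub (V : zmodType) (S : zmodClosed V) :=
  ZSub { zval : V; zvalP : zval \in S }.

HB.instance Definition _ (V : zmodType) (S : zmodClosed V) :=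
  [isSub for @zval V S].
HB.instance Definition _ (V : zmodType) (S : zmodClosed V) :=
  [Choice of zsub S by <:].
HB.instance Definition _ (V : zmodType) (S : zmodClosed V) :=
  [SubChoice_isSubZmodule of zsub S by <:].

Record naIdeal (R : naRingType) := NAIdeal {
  ideal_group :> zmodClosed R;
  idealMl : forall x y, y \in ideal_group -> x ** y \in ideal_group;
  idealMr : forall x y, x \in ideal_group -> x ** y \in ideal_group }.

Section QuotRing.
Variables (R : naRingType) (I : naIdeal R).

Definition quot_ring := {quot I}.
HB.instance Definition _ := GRing.Zmodule.on quot_ring.

Definition quot_one : quot_ring := \pi_({quot I}) naone.
Definition quot_mul : quot_ring -> quot_ring -> quot_ring :=
  @quot_op R R R (@namul R) I I I.

Fact quot_mulE x y :
  quot_mul (\pi_({quot I}) x) (\pi_({quot I}) y) = \pi_({quot I}) (x ** y).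
Proof.
exact: (quot_opE (@namulDl R) (@namulDr R) (fun x y => @idealMr R I x y)
                 (@idealMl R I)).
Qed.

Fact quot_mulDl x y z : quot_mul (x + y) z = quot_mul x z + quot_mul y z.
Proof.
exact: (quot_opDl (@namulDl R) (@namulDr R) (fun x y => @idealMr R I x y)
                 (@idealMl R I)).
Qed.

Fact quot_mulDr x y z : quot_mul x (y + z) = quot_mul x y + quot_mul x z.
Proof.
exact: (quot_opDr (@namulDl R) (@namulDr R) (fun x y => @idealMr R I x y)
                 (@idealMl R I)).
Qed.

Fact quot_mul1l x : quot_mul quot_one x = x.
Proof. by rewrite -[x]reprK quot_mulE namul1l. Qed.

Fact quot_mul1r x : quot_mul x quot_one = x.
Proof. by rewrite -[x]reprK quot_mulE namul1r. Qed.

HB.instance Definition _ := Zmodule_isNARing.Build quot_ring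
  quot_mulDl quot_mulDr quot_mul1l quot_mul1r.

(** [L] is a subspace of [N] with [I N] contained in [L], so that [N / L] is
    an [R / I]-space. *)
Record quot_subspace (N : naSpaceType R) := QuotSubspace {
  subspace_group :> zmodClosed N;
  subspaceM : forall a x, x \in subspace_group -> a **: x \in subspace_group;
  subspaceI : forall a x, a \in (I : zmodClosed R) -> a **: x \in subspace_group
}.

Variables (N : naSpaceType R) (L : quot_subspace N).

Definition quot_space := {quot L}.
HB.instance Definition _ := GRing.Zmodule.on quot_space.

Definition quot_act : quot_ring -> quot_space -> quot_space :=
  @quot_op R N N (@naact R N) I L L.

Fact quot_actE a x :
  quot_act (\pi_({quot I}) a) (\pi_({quot L}) x) = \pi_({quot L}) (a **: x).
Proof.
exact: (quot_opE (@naactDl R N) (@naactDr R N) (@subspaceI _ L) (@subspaceM _ L)).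
Qed.

Fact quot_actDl a b x : quot_act (a + b) x = quot_act a x + quot_act b x.
Proof.
exact: (quot_opDl (@naactDl R N) (@naactDr R N) (@subspaceI _ L) (@subspaceM _ L)).
Qed.

Fact quot_actDr a x y : quot_act a (x + y) = quot_act a x + quot_act a y.
Proof.
exact: (quot_opDr (@naactDl R N) (@naactDr R N) (@subspaceI _ L) (@subspaceM _ L)).
Qed.

Fact quot_act1 x : quot_act quot_one x = x.
Proof. by rewrite -[x]reprK quot_actE naact1. Qed.

HB.instance Definition _ := Zmodule_isNASpace.Build quot_ring quot_space
  quot_actDl quot_actDr quot_act1.

End QuotRing.

(** Each [F i] is a two-sided ideal, by [rfiltM] with [F 0 = R]. *)
Record ring_filtration (R : naRingType) := RingFiltration {
  rfilt :> nat -> zmodClosed R;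
  rfilt0 : forall x, x \in rfilt 0%N;
  rfiltS : forall i, {subset rfilt i.+1 <= rfilt i};
  rfiltM : forall i j x y,
    x \in rfilt i -> y \in rfilt j -> x ** y \in rfilt (i + j)%N }.

(** Each [G i] is an [R]-subspace, by [sfiltM] with [F 0 = R]. *)
Record space_filtration (R : naRingType) (F : ring_filtration R)
    (M : naSpaceType R) := SpaceFiltration {
  sfilt :> nat -> zmodClosed M;
  sfilt0 : forall x, x \in sfilt 0%N;
  sfiltS : forall i, {subset sfilt i.+1 <= sfilt i};
  sfiltM : forall i j a x,
    a \in F i -> x \in sfilt j -> a **: x \in sfilt (i + j)%N }.

Section DirectSum.
Variable V : zmodType.
Implicit Type F : nat -> zmodClosed V.

Definition dsum_set F : set (nat -> V) :=
  [set x | (forall i, x i \in F i) /\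
           exists N : nat, forall i, (N <= i)%N -> x i = 0].

Fact dsum_set0 F : dsum_set F 0.
Proof. by split=> [i|]; [exact: rpred0 | exists 0%N]. Qed.

Fact dsum_setB F x y : dsum_set F x -> dsum_set F y -> dsum_set F (x - y).
Proof.
move=> [xF [m xm]] [yF [n yn]]; split=> [i|]; first exact: (rpredB (xF i) (yF i)).
exists (maxn m n) => i; rewrite geq_max => /andP[mi ni].
have -> : (x - y) i = x i - y i by [].
by rewrite xm // yn // subrr.
Qed.

Definition dsum F := zsub (subgroup (dsum_set0 F) (@dsum_setB F)).
HB.instance Definition _ F := GRing.Zmodule.on (dsum F).

Lemma dsumP F (x : dsum F) : dsum_set F (zval x).
Proof. by have /subgroupP := zvalP x. Qed.

Definition dsum_shift_set F : set (dsum F) :=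
  [set x | forall i, zval x i \in F i.+1].

Fact dsum_shift_set0 F : dsum_shift_set (0 : dsum F).
Proof. by move=> i; exact: rpred0. Qed.

Fact dsum_shift_setB F (x y : dsum F) :
  dsum_shift_set x -> dsum_shift_set y -> dsum_shift_set (x - y).
Proof. by move=> xF yF i; exact: (rpredB (xF i) (yF i)). Qed.

(** The subgroup [\bigoplus_i F i.+1] of [\bigoplus_i F i], when [F] is
    decreasing *)
Definition dsum_shift F : zmodClosed (dsum F) :=
  subgroup (@dsum_shift_set0 F) (@dsum_shift_setB F).

Definition homogeneous F (i : nat) (x : dsum F) : Prop :=
  forall j, j <> i -> zval x j = 0.

End DirectSum.

Section GradedRing.
Variables (R : naRingType) (F : ring_filtration R).

Fact dsum_conv (V W : zmodType) (b : R -> V -> W)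
    (G : nat -> zmodClosed V) (H : nat -> zmodClosed W) :
  (forall x y z, b (x + y) z = b x z + b y z) ->
  (forall x y z, b x (y + z) = b x y + b x z) ->
  (forall i j x y, x \in F i -> y \in G j -> b x y \in H (i + j)%N) ->
  forall (x : dsum F) (y : dsum G),
    dsum_set H (conv b (zval x) (zval y)).
Proof.
move=> bDl bDr bH x y.
have [xF [m xm]] := dsumP x; have [yG [n yn]] := dsumP y.
split=> [k|].
  apply: rpred_sum => i _.
  have ik : (i <= k)%N by rewrite -ltnS ltn_ord.
  by rewrite -[X in H X](subnKC ik); apply: bH.
exists (m + n)%N => k mnk; rewrite /conv big1 // => i _.
have [mi|im] := leqP m i; first by rewrite xm // (biadd0l bDl).
rewrite yn ?(biadd0r bDr) // leq_subRL.
  by apply: leq_trans mnk; rewrite addnC [leqRHS]addnC leq_add2l ltnW.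
by rewrite -ltnS ltn_ord.
Qed.

Definition rees_ring := dsum F.
HB.instance Definition _ := GRing.Zmodule.on rees_ring.

Definition rees_mul (x y : rees_ring) : rees_ring :=
  ZSub (introT (subgroupP _ _ _)
    (dsum_conv (@namulDl R) (@namulDr R) (@rfiltM R F) x y)).

Fact rees_one_subproof :
  dsum_set F (fun i => if i == 0%N then naone else 0).
Proof.
split=> [[|i]|]; [exact: rfilt0|exact: rpred0|].
by exists 1%N => -[].
Qed.

Definition rees_one : rees_ring := ZSub (introT (subgroupP _ _ _) rees_one_subproof).

Fact rees_mulDl x y z : rees_mul (x + y) z = rees_mul x z + rees_mul y z.
Proof.
by apply/val_inj; exact: (convDl (@namulDl R) (zval x) (zval y) (zval z)).
Qed.

Fact rees_mulDr x y z : rees_mul x (y + z) = rees_mul x y + rees_mul x z.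
Proof.
by apply/val_inj; exact: (convDr (@namulDr R) (zval x) (zval y) (zval z)).
Qed.

Fact rees_mul1l x : rees_mul rees_one x = x.
Proof.
apply/val_inj/funext => n /=; rewrite /conv big_ord_recl /= namul1l subn0.
by rewrite big1 ?addr0 // => i _; rewrite (biadd0l (@namulDl R)).
Qed.

Fact rees_mul1r x : rees_mul x rees_one = x.
Proof.
apply/val_inj/funext => n /=; rewrite /conv big_ord_recr /= subnn eqxx namul1r.
rewrite big1 ?add0r // => i _; rewrite subn_eq0 leqNgt ltn_ord /=.
by rewrite (biadd0r (@namulDr R)).
Qed.

HB.instance Definition _ := Zmodule_isNARing.Build rees_ring
  rees_mulDl rees_mulDr rees_mul1l rees_mul1r.

Fact rees_shiftMl (x y : rees_ring) :
  y \in dsum_shift F -> x ** y \in dsum_shift F.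
Proof.
move=> /subgroupP yF; have [xF _] := dsumP x.
apply/subgroupP => n; apply: rpred_sum => i _.
have := rfiltM (xF i) (yF (n - i)%N).
by rewrite addnS subnKC // -ltnS ltn_ord.
Qed.

Fact rees_shiftMr (x y : rees_ring) :
  x \in dsum_shift F -> x ** y \in dsum_shift F.
Proof.
move=> /subgroupP xF; have [yF _] := dsumP y.
apply/subgroupP => n; apply: rpred_sum => i _.
have := rfiltM (xF i) (yF (n - i)%N).
by rewrite addSn subnKC // -ltnS ltn_ord.
Qed.

Definition rees_ideal : naIdeal rees_ring :=
  @NAIdeal rees_ring (dsum_shift F : zmodClosed rees_ring)
    rees_shiftMl rees_shiftMr.

(** [(\bigoplus_i F i) / (\bigoplus_i F i.+1) = \bigoplus_i F i / F i.+1] *)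
Definition gr_ring : naRingType := quot_ring rees_ideal.

Definition gr_component (i : nat) : set gr_ring :=
  [set \pi_(quot_ring rees_ideal) x | x in @homogeneous R F i].

Fact filt1Ml (x y : R) : y \in F 1%N -> x ** y \in F 1%N.
Proof. by move=> yF; rewrite -[1%N]add0n rfiltM ?rfilt0. Qed.

Fact filt1Mr (x y : R) : x \in F 1%N -> x ** y \in F 1%N.
Proof. by move=> xF; rewrite -[1%N]addn0 rfiltM ?rfilt0. Qed.

Definition max_ideal : naIdeal R := NAIdeal filt1Ml filt1Mr.

Definition residue_ring : naRingType := quot_ring max_ideal.

End GradedRing.

Arguments gr_component {R} F i _.

Section GradedSpace.
Variables (R : naRingType) (F : ring_filtration R).
Variables (M : naSpaceType R) (G : space_filtration F M).

Definition rees_space := dsum G.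
HB.instance Definition _ := GRing.Zmodule.on rees_space.

Definition rees_act (a : rees_ring F) (x : rees_space) : rees_space :=
  ZSub (introT (subgroupP _ _ _)
    (dsum_conv (@naactDl R M) (@naactDr R M) (@sfiltM R F M G) a x)).

Fact rees_actDl a b x : rees_act (a + b) x = rees_act a x + rees_act b x.
Proof.
by apply/val_inj; exact: (convDl (@naactDl R M) (zval a) (zval b) (zval x)).
Qed.

Fact rees_actDr a x y : rees_act a (x + y) = rees_act a x + rees_act a y.
Proof.
by apply/val_inj; exact: (convDr (@naactDr R M) (zval a) (zval x) (zval y)).
Qed.

Fact rees_act1 x : rees_act naone x = x.
Proof.
apply/val_inj/funext => n /=; rewrite /conv big_ord_recl /= naact1 subn0.
by rewrite big1 ?addr0 // => i _; rewrite (biadd0l (@naactDl R M)).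
Qed.

HB.instance Definition _ := Zmodule_isNASpace.Build (rees_ring F) rees_space
  rees_actDl rees_actDr rees_act1.

Fact rees_subspaceM (a : rees_ring F) (x : rees_space) :
  x \in dsum_shift G -> a **: x \in dsum_shift G.
Proof.
move=> /subgroupP xG; have [aF _] := dsumP a.
apply/subgroupP => n; apply: rpred_sum => i _.
have := sfiltM (aF i) (xG (n - i)%N).
by rewrite addnS subnKC // -ltnS ltn_ord.
Qed.

Fact rees_subspaceI (a : rees_ring F) (x : rees_space) :
  a \in dsum_shift F -> a **: x \in dsum_shift G.
Proof.
move=> /subgroupP aF; have [xG _] := dsumP x.
apply/subgroupP => n; apply: rpred_sum => i _.
have := sfiltM (aF i) (xG (n - i)%N).
by rewrite addSn subnKC // -ltnS ltn_ord.
Qed.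

Definition rees_subspace : quot_subspace (rees_ideal F) rees_space :=
  @QuotSubspace _ (rees_ideal F) rees_space
    (dsum_shift G : zmodClosed rees_space) rees_subspaceM rees_subspaceI.

Definition gr_space : naSpaceType (gr_ring F) := quot_space rees_subspace.

Section Layer.
Variable i : nat.

Definition filt_space := zsub (G i).
HB.instance Definition _ := GRing.Zmodule.on filt_space.

Fact filt_act_subproof (a : R) (x : filt_space) : a **: zval x \in G i.
Proof. by have := sfiltM (rfilt0 F a) (zvalP x); rewrite add0n. Qed.

Definition filt_act (a : R) (x : filt_space) : filt_space :=
  ZSub (filt_act_subproof a x).

Fact filt_actDl a b x : filt_act (a + b) x = filt_act a x + filt_act b x.
Proof. by apply/val_inj; exact: naactDl. Qed.

Fact filt_actDr a x y : filt_act a (x + y) = filt_act a x + filt_act a y.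
Proof. by apply/val_inj; exact: naactDr. Qed.

Fact filt_act1 x : filt_act naone x = x.
Proof. by apply/val_inj; rewrite /= naact1. Qed.

HB.instance Definition _ := Zmodule_isNASpace.Build R filt_space
  filt_actDl filt_actDr filt_act1.

Definition layer_set : set filt_space := [set x | zval x \in G i.+1].

Fact layer_set0 : layer_set 0.
Proof. exact: rpred0. Qed.

Fact layer_setB x y : layer_set x -> layer_set y -> layer_set (x - y).
Proof. by move=> xG yG; exact: (rpredB xG yG). Qed.

Definition layer_group : zmodClosed filt_space := subgroup layer_set0 layer_setB.

Fact layer_subspaceM (a : R) (x : filt_space) :
  x \in layer_group -> a **: x \in layer_group.
Proof.
move=> /subgroupP xG; apply/subgroupP.
by have := sfiltM (rfilt0 F a) xG; rewrite add0n.
Qed.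

Fact layer_subspaceI (a : R) (x : filt_space) :
  a \in F 1%N -> a **: x \in layer_group.
Proof.
move=> aF; apply/subgroupP.
by have := sfiltM aF (zvalP x); rewrite add1n.
Qed.

Definition layer : naSpaceType (residue_ring F) :=
  quot_space (@QuotSubspace R (max_ideal F) filt_space
    layer_group layer_subspaceM layer_subspaceI).

End Layer.

End GradedSpace.

Definition na_commutative_ring (S : naRingType) : Prop :=
  (forall x y : S, x ** y = y ** x) /\
  (forall x y z : S, x ** (y ** z) = x ** y ** z).

Definition na_field (K : naRingType) : Prop :=
  [/\ na_commutative_ring K, (naone : K) <> 0 &
      forall x : K, x <> 0 -> exists y, x ** y = naone].

(** [X] generates [S] as an algebra over the subring [A]. *)
Definition algebra_generated (S : naRingType) (A X : set S) : Prop :=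
  forall B : zmodClosed S,
    (forall x y, x \in B -> y \in B -> x ** y \in B) ->
    (forall x, A x -> x \in B) -> (forall x, X x -> x \in B) ->
  forall x, x \in B.

Definition finitely_generated_module (S : naRingType) (N : naSpaceType S) :
    Prop :=
  (forall (a b : S) (x : N), (a ** b) **: x = a **: (b **: x)) /\
  exists (n : nat) (e : 'I_n -> N),
    forall x : N, exists c : 'I_n -> S, x = \sum_(i < n) c i **: e i.

Definition has_basis (K : naRingType) (V : naSpaceType K) (d : nat) : Prop :=
  exists e : 'I_d -> V,
    forall x : V, exists! c : 'I_d -> K, x = \sum_(i < d) c i **: e i.

(** Meaningful for a finite-dimensional vector space over a field only *)
Definition vdim (K : naRingType) (V : naSpaceType K) : nat :=
  xget 0%N [set d | has_basis V d].

Definition prime_ideal (S : naRingType) (P : zmodClosed S) : Prop :=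
  [/\ forall x y, y \in P -> x ** y \in P,
      forall x y, x \in P -> x ** y \in P,
      naone \notin P &
      forall x y, x ** y \in P -> x \in P \/ y \in P].

Definition annihilator (S : naRingType) (N : naSpaceType S) : set S :=
  [set a | forall x : N, a **: x = 0].

(** A chain [p 0 < ... < p r] of prime ideals containing the annihilator of
    [N], i.e. of prime ideals of [S / Ann N] *)
Definition prime_chain (S : naRingType) (N : naSpaceType S) (r : nat)
    (p : nat -> zmodClosed S) : Prop :=
  (forall i, (i <= r)%N ->
     prime_ideal (p i) /\ (forall a, annihilator N a -> a \in p i)) /\
  (forall i, (i < r)%N ->
     {subset p i <= p i.+1} /\ ~ {subset p i.+1 <= p i}).

(** [d] is the supremum of the lengths of such chains, with [d = -1] when there
    is none, that is for [N = 0]; this is the convention under which the zero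
    polynomial has degree -1. *)
Definition is_krull_dim (S : naRingType) (N : naSpaceType S) (d : int) : Prop :=
  -1 <= d /\
  forall r : nat, (exists p, prime_chain N r p) <-> r%:Z <= d.

(** The value is -1 in infinite dimension. *)
Definition krull_dim (S : naRingType) (N : naSpaceType S) : int :=
  xget (-1) [set d | is_krull_dim N d].

(** Bijectivity of [R -> lim R / F i], elements of the limit being given by
    sequences of representatives *)
Definition complete_filtration (R : naRingType) (F : ring_filtration R) : Prop :=
  forall u : nat -> R, (forall i j, (i <= j)%N -> u j - u i \in F i) ->
    exists! x, forall i, x - u i \in F i.

(** [gr_component F 0] is the copy of [R / F 1] over which [gr_ring F] is an
    algebra. *)
Definition complete_local_filtered (R : naRingType) (F : ring_filtration R) :
    Prop :=
  [/\ complete_filtration F,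
      na_field (residue_ring F),
      na_commutative_ring (gr_ring F),
      exists X : seq (gr_ring F),
        algebra_generated (gr_component F 0) [set` X] &
      algebra_generated (gr_component F 0) (gr_component F 1)].

Section Permissible.
Variables (R : naRingType) (F : ring_filtration R) (M : naSpaceType R).

Definition separated (G : space_filtration F M) : Prop :=
  forall x : M, (forall i, x \in G i) -> x = 0.

Definition permissible (G : space_filtration F M) : Prop :=
  separated G /\ finitely_generated_module (gr_space G).

Definition is_hilbert_samuel (G : space_filtration F M) (P : {poly rat}) :
    Prop :=
  exists N : nat, forall n, (N <= n)%N ->
    P.[n%:R] = (\sum_(1 <= k < n.+1) vdim (layer G k.-1))%:R.

Definition hilbert_samuel (G : space_filtration F M) : {poly rat} :=
  xget 0 [set P | is_hilbert_samuel G P].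

(** [A M], the group of finite sums of products [a **: x] with [a] in [A] *)
Definition span_act (A : zmodClosed R) : set M :=
  [set x | exists (n : nat) (a : 'I_n -> R) (y : 'I_n -> M),
     (forall i, a i \in A) /\ x = \sum_(i < n) a i **: y i].

Fact span_act0 A : span_act A 0.
Proof.
exists 0%N, (fun=> 0), (fun=> 0); split=> [i|]; first exact: rpred0.
by rewrite big_ord0.
Qed.

Fact span_actB A x y : span_act A x -> span_act A y -> span_act A (x - y).
Proof.
move=> [m [a [u [aA ->]]]] [n [b [v [bA ->]]]].
exists (m + n)%N.
exists (fun i => match fintype.split i with inl j => a j | inr k => - b k end).
exists (fun i => match fintype.split i with inl j => u j | inr k => v k end).
split=> [i|]; first by case: (fintype.split i) => j; rewrite ?rpredN.
rewrite big_split_ord /= -sumrN; congr (_ + _); apply: eq_bigr => i _.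
  by rewrite -[lshift n i]/(unsplit (inl i)) unsplitK.
rewrite -[rshift m i]/(unsplit (inr i)) unsplitK.
by rewrite (biaddNl (@naactDl R M)).
Qed.

(** [M / m^n M], where [m^n] is [F n] *)
Definition quot_power (n : nat) : zmodType :=
  {quot subgroup (@span_act0 (F n)) (@span_actB (F n))}.

End Permissible.

(** The value is 0 on infinite types. *)
Definition card_type (T : choiceType) : nat := #|` fset_set [set: T]|.

(* Main.v *)
(** Lengths.  The residue field being finite, dimensions are replaced by
    [logn p] of indices of subgroups, [p] a prime divisor of [q]: this is
    additive in exact sequences and needs no scalars.

    Hilbert polynomial.  A finitely generated graded module over a polynomial
    ring is a family of subquotients [A i / B i] with operators of degree one
    commuting modulo [B]; the Hilbert-Serre induction on the number of variables
    uses the kernel and the cokernel of the last one, the kernel being finitely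
    generated by Hilbert's basis theorem.

    Krull dimension.  Let [h I n] be the length of [S / I] in degrees [< n],
    [S = gr R].  For primes [P] strictly inside [Q], multiplication by an element
    of [Q] outside [P] gives [h P (n + e) >= h P n + h Q n], so that a chain of
    [r] inclusions above [Ann (gr M)] forces growth of order at least [n ^ r].
    Conversely a homogeneous ideal maximal among those with
    [h I n <> o(n ^ d)] is prime, and adding to it an element of degree one
    lowers the growth by one degree; this yields a chain of length the degree of
    the Hilbert polynomial.

    Limit.  By completeness of [R], [F^(n+c) M] is contained in [m^n M], itself
    contained in [F^n M], for a constant [c]; hence [log_q |M / m^n M|] lies
    between the values at [n] and [n + c] of the Hilbert-Samuel polynomial. *)

Require Import Defs.
From mathcomp Require Import all_boot all_order all_algebra finmap.
From mathcomp Require Import all_classical all_reals all_analysis.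
From mathcomp Require Import zify.

Set Implicit Arguments.
Unset Strict Implicit.
Unset Printing Implicit Defensive.

Import Order.TTheory GRing.Theory Num.Theory.
Import numFieldNormedType.Exports.

Local Open Scope ring_scope.
Local Open Scope classical_set_scope.
Local Open Scope card_scope.
Local Open Scope quotient_scope.

Local Notation "{ 'quot' I }" := (Quotient.quot I) : type_scope.

(** * Indices of subgroups *)

(** Associativity and commutativity are available only on [gr R] and [gr M], so all commutative
    algebra is done there. The return to [R] and [M] uses sums of products [a **: x] with [x] in a
    fixed finite family: corrections are made in the coefficients alone, and nothing is ever
    reassociated. The primes in the definition of Krull dimension are arbitrary, while Hilbert
    functions by degree belong to homogeneous ideals. The remedy is to measure the image in [S / I]
    of all degrees [< n] together, which makes sense for every subgroup [I]. The inequality for a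
    given chain of primes then needs no homogeneity; only the primes that are constructed are
    homogeneous. The prime [p] is taken to divide [q] so that the residue field itself has positive
    length. Every layer has index a power of [q], and division by the exponent of [p] in [q] turns
    lengths back into dimensions at the end. *)

Lemma subrACA (V : zmodType) (x y u v : V) :
  x - y - (u - v) = (x - u) - (y - v).
Proof. by rewrite !opprB [v - u]addrC addrACA [- y + v]addrC. Qed.

(** Two maps with the same fibres have images of the same size: [r] selects one point in each fibre,
    and both images are in bijection with the selected points. *)
Lemma card_image_eq (T : choiceType) (X Y : Type) (A : set T)
    (u : T -> X) (v : T -> Y) :
  (forall a b, A a -> A b -> (u a = u b <-> v a = v b)) ->
  u @` A #= v @` A.
Proof.
move=> uv; have [->|/set0P[a0 _]] := eqVneq A set0; first by rewrite !image_set0.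
pose r a := xget a0 [set b | A b /\ u b = u a].
have rA a : A a -> A (r a) /\ u (r a) = u a.
  by move=> Aa; apply: (@xgetPex _ a0 [set b | A b /\ u b = u a]); exists a.
have rE a b : A a -> A b -> u a = u b -> r a = r b.
  by move=> _ _ e; rewrite /r e.
have img (Z : Type) (w : T -> Z) :
    (forall a b, A a -> A b -> (u a = u b <-> w a = w b)) ->
    w @` A #= r @` A.
  move=> uw; have -> : w @` A = w @` (r @` A).
    apply/seteqP; split=> [_ [a Aa <-]|_ [_ [a Aa <-] <-]].
      exists (r a); first by exists a.
      by have [Ara ra] := rA a Aa; apply/uw.
    by exists a => //; have [Ara ra] := rA a Aa; apply/uw.
  apply: inj_card_eq => _ _ /set_mem[a Aa <-] /set_mem[b Ab <-] e.
  have [Ara ra] := rA a Aa; have [Arb rb] := rA b Ab.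
  by apply: rE => //; rewrite -ra -rb; apply/uw.
by apply: card_eq_trans (img _ _ _) _ => //; rewrite card_eq_sym; exact: img.
Qed.

Lemma card_fsetX (X Y : choiceType) (A : {fset X}) (B : {fset Y}) :
  #|` (A `*` B)%fset| = (#|` A| * #|` B|)%N.
Proof.
rewrite /= -(size_allpairs pair); apply/perm_size/uniq_perm => [||[x y]].
- exact: fset_uniq.
- by apply: allpairs_uniq; rewrite ?fset_uniq // => -[? ?] [? ?].
rewrite in_fsetM /=; apply/andP/allpairsP => [[xA yB]|[[a b] [aA bB [-> ->]]]//].
by exists (x, y).
Qed.

Section Index.
Variable V : zmodType.
Implicit Types A B C : set V.

Definition subgrp A := A 0 /\ forall x y, A x -> A y -> A (x - y).

Lemma subgrpN A x : subgrp A -> A x -> A (- x).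
Proof. by move=> [A0 AB] Ax; rewrite -[- x]add0r; exact: AB. Qed.

Lemma subgrpD A x y : subgrp A -> A x -> A y -> A (x + y).
Proof.
by move=> sA Ax Ay; rewrite -[y]opprK; apply: sA.2 => //; exact: subgrpN.
Qed.

Lemma subgrp_sum A (I : Type) (s : seq I) (P : pred I) (F : I -> V) :
  subgrp A -> (forall i, P i -> A (F i)) -> A (\sum_(i <- s | P i) F i).
Proof.
by move=> sA AF; apply: big_ind => //; [exact: sA.1|move=> x y; exact: subgrpD].
Qed.

Lemma subgrpBC A x y : subgrp A -> A (x - y) -> A (y - x).
Proof. by move=> sA /(subgrpN sA); rewrite opprB. Qed.

Lemma subgrp_subr A x y : subgrp A -> A x -> A (x - y) -> A y.
Proof. by move=> sA Ax Axy; rewrite -[y](subKr x); exact: sA.2. Qed.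

Lemma subgrp_addr A x y : subgrp A -> A y -> A (x - y) -> A x.
Proof. by move=> sA Ay Axy; rewrite -(subrK y x); exact: subgrpD. Qed.

Lemma subgrpI A B : subgrp A -> subgrp B -> subgrp (A `&` B).
Proof.
move=> [A0 AB] [B0 BB]; split=> // x y [Ax Bx] [Ay By].
by split; [exact: AB|exact: BB].
Qed.

Lemma subgrpT : subgrp setT. Proof. by []. Qed.

Lemma subgrp0 : subgrp [set 0].
Proof. by split=> // x y /= -> ->; rewrite subr0. Qed.

Lemma subgrp_zmodClosed (A : zmodClosed V) : subgrp [set x | x \in A].
Proof. by split=> [|x y /=]; [exact: rpred0|exact: rpredB]. Qed.

Definition sumset A B : set V := [set x | exists2 a, A a & B (x - a)].

Lemma subgrp_sumset A B : subgrp A -> subgrp B -> subgrp (sumset A B).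
Proof.
move=> sA sB; split=> [|x y [a Aa Bx] [b Ab By]].
  by exists 0; [exact: sA.1|rewrite subr0; exact: sB.1].
exists (a - b); first exact: sA.2.
by rewrite subrACA; exact: sB.2.
Qed.

Lemma sumset_l A B : subgrp B -> A `<=` sumset A B.
Proof. by move=> sB x Ax; exists x; rewrite ?subrr //; exact: sB.1. Qed.

Lemma sumset_r A B : subgrp A -> B `<=` sumset A B.
Proof. by move=> sA x Bx; exists 0; [exact: sA.1|rewrite subr0]. Qed.

Lemma sumset_sub A B C :
  subgrp C -> A `<=` C -> B `<=` C -> sumset A B `<=` C.
Proof. by move=> sC AC BC x [a /AC Ca /BC Cx]; exact: subgrp_addr Ca Cx. Qed.

Definition coset B x : set V := [set y | B (y - x)].
(** [B] need not lie in [A]: for subgroups these are the cosets of [B] meeting [A], so their number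
    is the index of the intersection in [A]. Counting sets avoids a quotient type for each pair. *)
Definition cosets A B : set (set V) := coset B @` A.
Definition fin_index A B := finite_set (cosets A B).
Definition sgindex A B := #|` fset_set (cosets A B)|.

Lemma coset_eq B x y : subgrp B -> coset B x = coset B y <-> B (y - x).
Proof.
move=> sB; split=> [e|Byx].
  have : coset B y y by rewrite /coset /= subrr; exact: sB.1.
  by rewrite -e.
apply/seteqP; split=> z; rewrite /coset /= => Bz.
  by rewrite -(subrKA x); apply: subgrpD => //; exact: subgrpBC.
by rewrite -(subrKA y); exact: subgrpD.
Qed.

Lemma index_gt0 A B : fin_index A B -> subgrp A -> (0 < sgindex A B)%N.
Proof.
move=> fAB [A0 _]; rewrite cardfs_gt0; apply/fset0Pn; exists (coset B 0).
by rewrite in_fset_set // inE; exists 0.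
Qed.

Lemma fin_indexS A A' B : A' `<=` A -> fin_index A B -> fin_index A' B.
Proof. by move=> A'A; apply: sub_finite_set; exact: image_subset. Qed.

Lemma index1 A B : subgrp A -> subgrp B -> A `<=` B -> sgindex A B = 1%N.
Proof.
move=> sA sB AB; have -> : sgindex A B = #|` fset_set [set coset B 0]|.
  congr (#|` fset_set _|); apply/seteqP; split=> [_ [a Aa <-]|_ ->].
    by apply/coset_eq => //; rewrite sub0r; apply: subgrpN => //; exact: AB.
  by exists 0 => //; exact: sA.1.
by rewrite fset_set1 cardfs1.
Qed.

(** With [r a] a representative depending only on the coset of [a] modulo [B], the pair of the coset
    of [a] modulo [B] and the coset of [a - r a] modulo [C] determines [a] modulo [C] and takes all
    values. *)
Lemma index_mul A B C : subgrp A -> subgrp B -> subgrp C -> C `<=` B ->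
  fin_index A B -> fin_index (A `&` B) C ->
  fin_index A C /\ sgindex A C = (sgindex A B * sgindex (A `&` B) C)%N.
Proof.
move=> sA sB sC CB fAB fBC.
pose r a := xget 0 [set b | A b /\ coset B b = coset B a].
have rA a : A a -> A (r a) /\ B (a - r a).
  move=> Aa; have [] : A (r a) /\ coset B (r a) = coset B a.
    by apply: (@xgetPex _ 0 [set b | A b /\ coset B b = coset B a]); exists a.
  by move=> Ara /(coset_eq _ _ sB).
have rE a b : coset B a = coset B b -> r a = r b by rewrite /r => ->.
pose v a := (coset B a, coset C (a - r a)).
have uv a b : A a -> A b -> (coset C a = coset C b <-> v a = v b).
  move=> Aa Ab; split.
    move=> /(coset_eq _ _ sC) Cba.
    have e : coset B a = coset B b by apply/coset_eq => //; exact: CB.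
    rewrite /v (rE _ _ e) e; congr (_, _); apply/coset_eq => //.
    by rewrite opprB addrA subrK.
  move=> [e]; rewrite (rE _ _ e) => /(coset_eq _ _ sC).
  by rewrite opprB addrA subrK => Cba; apply/coset_eq.
have im : v @` A = cosets A B `*` cosets (A `&` B) C.
  apply/seteqP; split=> [_ [a Aa <-]|[_ _] /= [[a Aa <-] [b [Ab Bb] <-]]].
    have [Ara Br] := rA a Aa; split; first by exists a.
    by exists (a - r a) => //; split=> //; exact: sA.2.
  have [Ara Br] := rA a Aa.
  exists (r a + b); first exact: subgrpD.
  have e : coset B (r a + b) = coset B a.
    by apply/coset_eq => //; rewrite opprD addrA; exact: sB.2.
  by rewrite /v (rE _ _ e) e addrAC subrr add0r.
have eq : cosets A C #= cosets A B `*` cosets (A `&` B) C.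
  by rewrite -im; exact: card_image_eq.
have fin : fin_index A C.
  by rewrite /fin_index (eq_finite_set eq); exact: finite_setX.
split=> //; have /finite_setP[n AC] := fin.
rewrite /sgindex (card_fset_set AC) -card_fsetX -fset_setX //.
by rewrite (@card_fset_set _ _ n) // -(card_eql eq).
Qed.

(** The coset modulo [B] is a function [g] of the coset modulo [C]. *)
Lemma fin_indexl A B C : subgrp B -> subgrp C -> C `<=` B ->
  fin_index A C -> fin_index A B.
Proof.
move=> sB sC CB fAC; rewrite /fin_index.
pose g (X : set V) := [set y | exists2 x, X x & B (y - x)].
have gE a : A a -> coset B a = g (coset C a).
  move=> Aa; apply/seteqP; split=> y.
    by move=> Bya; exists a => //; rewrite /coset /= subrr; exact: sC.1.
  by move=> [x /CB Bxa Byx]; rewrite /coset /= -(subrKA x); exact: subgrpD.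
have -> : cosets A B = g @` cosets A C; last exact: finite_image.
apply/seteqP; split=> [_ [a Aa <-]|_ [_ [a Aa <-] <-]].
  by exists (coset C a); [exists a|rewrite gE].
by exists a; rewrite ?gE.
Qed.

End Index.

Section CosetBijection.
Variables (V W : zmodType) (f : V -> W) (A B : set V) (A' B' : set W).
Hypotheses (sA : subgrp A) (sB : subgrp B) (sB' : subgrp B').
Hypothesis fB : forall x y, A x -> A y -> f (x - y) = f x - f y.
Hypothesis fA : forall a, A a -> A' (f a).

Lemma index_bij :
  (forall a, A a -> (B' (f a) <-> B a)) ->
  (forall a', A' a' -> exists2 a, A a & B' (a' - f a)) ->
  cosets A B #= cosets A' B'.
Proof.
move=> ker surj.
have -> : cosets A' B' = (fun a => coset B' (f a)) @` A.
  apply/seteqP; split=> [_ [a' A'a' <-]|_ [a Aa <-]].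
    have [a Aa Baa] := surj a' A'a'; exists a => //.
    exact/coset_eq.
  by exists (f a) => //; exact: fA.
apply: card_image_eq => a b Aa Ab.
by rewrite !coset_eq // -fB //; symmetry; apply: ker; exact: sA.2.
Qed.

End CosetBijection.

Lemma index_eq (V W : zmodType) (A B : set V) (A' B' : set W) :
  fin_index A' B' -> cosets A B #= cosets A' B' ->
  fin_index A B /\ sgindex A B = sgindex A' B'.
Proof.
move=> fA e; have /finite_setP[n An] := fA.
have Bn : cosets A B #= `I_n by rewrite (card_eql e).
by split; [apply/finite_setP; exists n|rewrite /sgindex !(@card_fset_set _ _ n)].
Qed.

Lemma index_mulS (V : zmodType) (A B C : set V) :
  subgrp A -> subgrp B -> subgrp C -> C `<=` B -> fin_index A C ->
  sgindex A C = (sgindex A B * sgindex (A `&` B) C)%N.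
Proof.
move=> sA sB sC CB fAC; apply: (index_mul sA sB sC CB _ _).2.
  exact: fin_indexl CB fAC.
by apply: fin_indexS fAC; exact: subIsetl.
Qed.

Section IndexMap.
Variables (V W : zmodType) (f : V -> W) (A B : set V) (A' B' : set W).
Hypotheses (sA : subgrp A) (sB : subgrp B) (sA' : subgrp A') (sB' : subgrp B').
Hypothesis fB : forall x y, A x -> A y -> f (x - y) = f x - f y.
Hypothesis fA : forall a, A a -> A' (f a).

(** [f] identifies the cosets of [B] in [A] with those of [B'] in the part of [A'] lying in [D], the
    image plus [B']; multiplicativity along [D] gives divisibility and not just an inequality. *)
Lemma index_inj : (forall a, A a -> (B' (f a) <-> B a)) -> fin_index A' B' ->
  fin_index A B /\ (sgindex A B %| sgindex A' B')%N.
Proof.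
move=> ker fin; pose D := sumset (f @` A) B'.
have f0 : f 0 = 0 by rewrite -[0](subr0 0) (fB sA.1 sA.1) subrr.
have sI : subgrp (f @` A).
  split=> [|_ _ [a Aa <-] [b Ab <-]]; first by exists 0 => //; exact: sA.1.
  by exists (a - b); [exact: sA.2|exact: fB].
have sD : subgrp D by exact: subgrp_sumset.
have BD : B' `<=` D by exact: sumset_r.
have fin' : fin_index (A' `&` D) B'.
  by apply: fin_indexS fin; exact: subIsetl.
have [] := @index_eq _ _ A B _ _ fin' _; last first.
  by move=> ? ->; split=> //; rewrite (index_mulS sA' sD) // dvdn_mull.
apply: (@index_bij _ _ f) => //.
  by move=> a Aa; split; [exact: fA|apply: sumset_l => //; exists a].
by move=> y [_ [_ [a Aa <-] Ba]]; exists a.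
Qed.

Lemma index_surj : (forall a, A a -> B a -> B' (f a)) ->
  (forall a', A' a' -> exists2 a, A a & B' (a' - f a)) -> fin_index A B ->
  fin_index A' B' /\ (sgindex A' B' %| sgindex A B)%N.
Proof.
move=> ker surj fin; pose D := sumset [set a | A a /\ B' (f a)] B.
have f0 : f 0 = 0 by rewrite -[0](subr0 0) (fB sA.1 sA.1) subrr.
have sI : subgrp [set a | A a /\ B' (f a)].
  split=> [|a b [Aa Ba] [Ab Bb]] /=.
    by rewrite f0; split; [exact: sA.1|exact: sB'.1].
  by rewrite fB //; split; [exact: sA.2|exact: sB'.2].
have sD : subgrp D by exact: subgrp_sumset.
have BD : B `<=` D by exact: sumset_r.
have fin' : fin_index A D by exact: fin_indexl fin.
have e : cosets A D #= cosets A' B'.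
  apply: (@index_bij _ _ f) => // a Aa; split=> [Ba|[b [Ab Bb] Bab]].
    by exists a; rewrite ?subrr //; exact: sB.1.
  apply: subgrp_addr (Bb) _ => //; rewrite -fB //; apply: ker => //.
  exact: sA.2.
rewrite card_eq_sym in e.
have [? ->] := index_eq fin' e; split=> //.
by rewrite (index_mulS sA sD sB) // dvdn_mulr.
Qed.

End IndexMap.

(** The prime-exponent of the index is additive along chains of subgroups and,
    because indices divide each other, monotone; it plays the role of the
    dimension without requiring scalars. *)
Definition len (p : nat) (V : zmodType) (A B : set V) := logn p (sgindex A B).

Section Len.
Variable p : nat.

Lemma leq_len (V W : zmodType) (A B : set V) (A' B' : set W) :
  fin_index A' B' -> subgrp A' -> (sgindex A B %| sgindex A' B')%N ->
  (len p A B <= len p A' B')%N.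
Proof. by move=> fin sA' dv; apply: dvdn_leq_log => //; exact: index_gt0. Qed.

Lemma len_mul (V : zmodType) (A B C : set V) :
  subgrp A -> subgrp B -> subgrp C -> C `<=` B -> fin_index A C ->
  len p A C = (len p A B + len p (A `&` B) C)%N.
Proof.
move=> sA sB sC CB fAC; rewrite /len (index_mulS sA sB) // lognM //.
  by apply: index_gt0 => //; exact: fin_indexl fAC.
apply: index_gt0; last exact: subgrpI.
by apply: fin_indexS fAC; exact: subIsetl.
Qed.

Lemma len1 (V : zmodType) (A B : set V) : subgrp A -> subgrp B -> A `<=` B ->
  len p A B = 0%N.
Proof. by move=> sA sB AB; rewrite /len index1 // logn1. Qed.

Lemma len_inj (V W : zmodType) (f : V -> W) (A B : set V) (A' B' : set W) :
  subgrp A -> subgrp B -> subgrp A' -> subgrp B' ->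
  (forall x y, A x -> A y -> f (x - y) = f x - f y) ->
  (forall a, A a -> A' (f a)) ->
  (forall a, A a -> (B' (f a) <-> B a)) -> fin_index A' B' ->
  (len p A B <= len p A' B')%N.
Proof.
move=> sA sB sA' sB' fB fA ker fin.
by apply: leq_len => //; apply: (index_inj sA sB sA' sB' fB fA ker fin).2.
Qed.

Lemma len_surj (V W : zmodType) (f : V -> W) (A B : set V) (A' B' : set W) :
  subgrp A -> subgrp B -> subgrp B' ->
  (forall x y, A x -> A y -> f (x - y) = f x - f y) ->
  (forall a, A a -> A' (f a)) ->
  (forall a, A a -> B a -> B' (f a)) ->
  (forall a', A' a' -> exists2 a, A a & B' (a' - f a)) -> fin_index A B ->
  (len p A' B' <= len p A B)%N.
Proof.
move=> sA sB sB' fB fA ker surj fin.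
by apply: leq_len => //; apply: (index_surj sA sB sB' fB fA ker surj fin).2.
Qed.

Lemma len_bij (V W : zmodType) (f : V -> W) (A B : set V) (A' B' : set W) :
  subgrp A -> subgrp B -> subgrp B' ->
  (forall x y, A x -> A y -> f (x - y) = f x - f y) ->
  (forall a, A a -> A' (f a)) ->
  (forall a, A a -> (B' (f a) <-> B a)) ->
  (forall a', A' a' -> exists2 a, A a & B' (a' - f a)) ->
  fin_index A' B' -> len p A B = len p A' B'.
Proof.
move=> sA sB sB' fB fA ker surj fin.
have e := index_bij sA sB sB' fB fA ker surj.
by rewrite /len (index_eq fin e).2.
Qed.

End Len.

(** * Sums of images under a family of operators *)

Section Operators.
Variables (V : zmodType) (f : nat -> V -> V).
Hypothesis fB : forall j x y, f j (x - y) = f j x - f j y.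

Lemma op0 j : f j 0 = 0.
Proof. by have := fB j 0 0; rewrite subr0 subrr. Qed.
Lemma opN j x : f j (- x) = - f j x.
Proof. by rewrite -[- x]sub0r fB op0 sub0r. Qed.
Lemma opD j x y : f j (x + y) = f j x + f j y.
Proof. by rewrite -{1}[y]opprK fB opN opprK. Qed.
Lemma iterB k j x y : iter k (f j) (x - y) = iter k (f j) x - iter k (f j) y.
Proof. by elim: k => //= k ->; rewrite fB. Qed.

(** The sum of the images of [A] under [f 0], ..., [f (r - 1)]; for a graded module, what the first
    [r] variables produce from one degree in the next. *)
Fixpoint opsum (r : nat) (A : set V) : set V :=
  if r is r'.+1 then [set y | exists2 a, A a & opsum r' A (y - f r' a)]
  else [set 0].

Lemma subgrp_opsum r A : subgrp A -> subgrp (opsum r A).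
Proof.
move=> sA; elim: r => [|r IH] /=; first exact: subgrp0.
split=> [|x y [a Aa xa] [b Ab yb]].
  by exists 0; [exact: sA.1|rewrite op0 subr0; exact: IH.1].
exists (a - b); first exact: sA.2.
by rewrite fB subrACA; exact: IH.2.
Qed.

Lemma opsum_sub r (A B : set V) : A `<=` B -> opsum r A `<=` opsum r B.
Proof.
move=> AB; elim: r => // r IH x [a Aa xa].
by exists a; [exact: AB|exact: IH].
Qed.

Lemma opsum_in r (A : set V) j a : subgrp A -> (j < r)%N -> A a ->
  opsum r A (f j a).
Proof.
move=> sA; elim: r => // r IH; rewrite ltnS leq_eqVlt => /predU1P[->|jr] Aa /=.
  by exists a => //; rewrite subrr; exact: (subgrp_opsum r sA).1.
by exists 0; [exact: sA.1|rewrite op0 subr0; exact: IH].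
Qed.

Lemma opsum_le r (A B : set V) : subgrp B ->
  (forall j a, (j < r)%N -> A a -> B (f j a)) -> opsum r A `<=` B.
Proof.
move=> sB; elim: r => [_ _ ->|r IH AB x [a Aa xa]]; first exact: sB.1.
apply: subgrp_addr sB (AB r a (ltnSn r) Aa) _.
by apply: IH xa => j b jr; exact: AB (ltnW jr).
Qed.

End Operators.

Lemma opsum_map (V W : zmodType) (f : nat -> V -> V) (f' : nat -> W -> W)
    (h : V -> W) r (A : set V) (B : set W) : (forall x y, h (x - y) = h x - h y) ->
  (forall j x, h (f j x) = f' j (h x)) -> (forall x, A x -> B (h x)) ->
  forall x, opsum f r A x -> opsum f' r B (h x).
Proof.
move=> hB hf hA; elim: r => [|r IH] x /=.
  by move=> ->; have := hB 0 0; rewrite !subr0 subrr.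
by move=> [a Aa xa]; exists (h a); [exact: hA|rewrite -hf -hB; exact: IH].
Qed.

(** * Noetherian property and Hilbert polynomials *)

Lemma bounded_choice (P : nat -> nat -> Prop) :
  (forall i, exists J, P i J) ->
  (forall i J J', (J <= J')%N -> P i J -> P i J') ->
  forall c, exists J, forall i, (i < c)%N -> P i J.
Proof.
move=> exP mono; elim=> [|c [J JP]]; first by exists 0%N.
have [K KP] := exP c; exists (maxn J K) => i.
rewrite ltnS leq_eqVlt => /predU1P[->|ic].
  by apply: mono KP; exact: leq_maxr.
by apply: mono (JP i ic); exact: leq_maxl.
Qed.

Lemma chain_leq (T : Type) (L : nat -> set T) :
  (forall n, L n `<=` L n.+1) -> forall m n, (m <= n)%N -> L m `<=` L n.
Proof.
move=> LS m n /subnK <-; elim: (n - m)%N => // k IH.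
by apply: subset_trans IH _; exact: LS.
Qed.

(** Each coset of [B] that ever enters the chain does so by a stage [g X]; there are finitely many
    cosets, and the largest of these stages works. *)
Lemma fin_chain (V : zmodType) (A B : set V) (L : nat -> set V) :
  subgrp B -> fin_index A B -> (forall n, subgrp (L n)) ->
  (forall n, B `<=` L n) -> (forall n, L n `<=` A) ->
  (forall n, L n `<=` L n.+1) ->
  exists J, forall n, (J <= n)%N -> L n `<=` L J.
Proof.
move=> sB fin sL BL LA LS.
have /choice[g gP] : forall X : set V, exists n, forall m a,
    L m a -> coset B a = X -> L n a.
  move=> X.
  have [[m [a [Lma aX]]]|no] := pselect (exists m a, L m a /\ coset B a = X).
    exists m => k b Lkb bX; apply: (@subgrp_addr _ (L m) b a) => //.
    by apply/BL/coset_eq => //; rewrite aX bX.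
  by exists 0%N => m a Lma aX; case: no; exists m, a.
have /finite_seqP[s Es] := fin.
exists (\max_(X <- s) g X)%N => n _ a La.
have : (g (coset B a) <= \max_(X <- s) g X)%N.
  apply: leq_bigmax_seq => //.
  by have : cosets A B (coset B a) by [exists a => //; exact: LA La]; rewrite Es.
by move=> /(chain_leq LS); apply; exact: gP La _.
Qed.

Section HilbertSerre.
Variables (V : zmodType) (f : nat -> V -> V).
Hypothesis fB : forall j x y, f j (x - y) = f j x - f j y.

(** The graded module [\bigoplus_i A i / B i] over the polynomial ring whose
    variables act through the operators [f j]; these only have to commute
    modulo [B]. *)
Record subquotient (A B : nat -> set V) := Subquotient {
  sq_sgA : forall i, subgrp (A i);
  sq_sgB : forall i, subgrp (B i);
  sq_sub : forall i, B i `<=` A i;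
  sq_fin : forall i, fin_index (A i) (B i);
  sq_opA : forall j i a, A i a -> A i.+1 (f j a);
  sq_opB : forall j i a, B i a -> B i.+1 (f j a);
  sq_comm : forall j k i a, A i a -> B i.+2 (f j (f k a) - f k (f j a)) }.

(** Finite generation over the first [r] variables: since every [A i / B i] is finite, it suffices
    that the variables generate all degrees beyond some bound. *)
Definition ev_generated r (A B : nat -> set V) := exists c, forall i,
  (c <= i)%N -> A i.+1 `<=` sumset (opsum f r (A i)) (B i.+1).

Definition stable r (L : nat -> set V) :=
  (forall i, subgrp (L i)) /\
  forall j i a, (j < r)%N -> L i a -> L i.+1 (f j a).

(** [A / opshift] is the cokernel of the variable [f r], and [opker / B], defined next, is its
    kernel. *)
Definition opshift r (A B : nat -> set V) (i : nat) : set V :=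
  if i is i'.+1 then sumset [set f r a | a in A i'] (B i) else B i.

Definition opker r (A B : nat -> set V) (i : nat) : set V :=
  [set a | A i a /\ B i.+1 (f r a)].

Section Step.
Variables (r : nat) (A B : nat -> set V).
Hypothesis AB : subquotient A B.

Let sA := sq_sgA AB.
Let sB := sq_sgB AB.
Let BA := sq_sub AB.
Let opA := sq_opA AB.
Let opB := sq_opB AB.
Let comm := sq_comm AB.

Lemma subgrp_image j i : subgrp [set f j a | a in A i].
Proof.
split=> [|_ _ [a Aa <-] [b Ab <-]].
  by exists 0; [exact: (sA i).1|exact: (op0 fB)].
by exists (a - b); [exact: (sA i).2|exact: fB].
Qed.

Lemma sub_opshift i : B i `<=` opshift r A B i.
Proof. by case: i => // i; apply: sumset_r; exact: subgrp_image. Qed.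

Lemma subquotient_opshift : subquotient A (opshift r A B).
Proof.
have sB' i : subgrp (opshift r A B i).
  by case: i => [|i] //=; apply: subgrp_sumset => //; exact: subgrp_image.
split=> //.
- case=> [|i]; first exact: (@BA 0%N).
  apply: sumset_sub => //.
  by move=> _ [a Aa <-]; exact: opA.
- by move=> i; apply: (fin_indexl (sB' i) (sB i) (@sub_opshift i) (sq_fin AB i)).
- move=> j [|i] a /=.
    by move=> Ba; apply: sumset_r; [exact: subgrp_image|exact: opB].
  move=> [_ [b Ab <-] Bab]; exists (f r (f j b)).
    by exists (f j b) => //; exact: opA.
  have := subgrpD (sB i.+2) (opB j Bab) (comm j r Ab).
  by rewrite fB subrKA.
- by move=> j k i a Aa; apply: sub_opshift; exact: comm.
Qed.

Lemma subquotient_opker : subquotient (opker r A B) B.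
Proof.
split=> //.
- move=> i; split=> [|a b [Aa Ba] [Ab Bb]] /=.
    by split; [exact: (sA i).1|rewrite /= (op0 fB); exact: (sB i.+1).1].
  by split; [exact: (sA i).2|rewrite /= fB; exact: (sB i.+1).2].
- by move=> i b Bb; split; [exact: @BA _ _ Bb|exact: opB].
- by move=> i; apply: fin_indexS (sq_fin AB i) => a [].
- move=> j i a [Aa Ba]; split; first exact: opA.
  by apply: subgrp_addr (opB j Ba) (comm r j Aa).
- by move=> j k i a [Aa _]; exact: comm.
Qed.

Lemma ev_generated_opshift :
  ev_generated r.+1 A B -> ev_generated r A (opshift r A B).
Proof.
move=> [c gen]; exists c => i ci x /(gen i ci)[y [a Aa ya] Bxy].
exists (y - f r a) => //=; exists (f r a); first by exists a.
by rewrite opprB addrCA addrAC subrr add0r.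
Qed.

Lemma iter_op k j i a : A i a -> A (i + k)%N (iter k (f j) a).
Proof. by elim: k => [|k IH] Aa; rewrite ?addn0 // addnS; exact/opA/IH. Qed.

Lemma iter_opB k j i a : B i a -> B (i + k)%N (iter k (f j) a).
Proof. by elim: k => [|k IH] Ba; rewrite ?addn0 // addnS; exact/opB/IH. Qed.

Lemma iter_comm k j l i a : A i a ->
  B (i + k).+1 (iter k (f j) (f l a) - f l (iter k (f j) a)).
Proof.
move=> Aa; elim: k => [|k IH] /=; first by rewrite subrr; exact: (sB _).1.
rewrite -(subrKA (f j (f l (iter k (f j) a)))) -fB addnS.
apply: subgrpD => //; first exact: opB.
by apply: comm => //; exact: iter_op.
Qed.

(** [colon L j] is the image of [(L : x^j)] in the cokernel of [x = f r]. *)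
Definition colon (L : nat -> set V) (j i : nat) : set V :=
  sumset [set a | A i a /\ L (i + j)%N (iter j (f r) a)] (opshift r A B i).

Lemma subgrp_colon0 (L : nat -> set V) j i : (forall i, subgrp (L i)) ->
  subgrp [set a | A i a /\ L (i + j)%N (iter j (f r) a)].
Proof.
move=> sL; split=> [|a b [Aa La] [Ab Lb]] /=.
  split; first exact: (sA i).1.
  have -> : iter j (f r) 0 = 0 by have := iterB fB j r 0 0; rewrite !subr0 subrr.
  exact: (sL _).1.
by rewrite (iterB fB); split; [exact: (sA i).2|exact: (sL _).2].
Qed.

Lemma stable_colon (L : nat -> set V) j :
  (forall i, B i `<=` L i) -> stable r L -> stable r (colon L j).
Proof.
move=> BL [sL opL]; have AB' := subquotient_opshift; split=> [i|k i a kr].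
  by apply: subgrp_sumset (sq_sgB AB' i); exact: subgrp_colon0.
move=> [b [Ab Lb] Bab]; exists (f k b); last by rewrite -fB; exact: (sq_opB AB').
split; first exact: opA.
apply: subgrp_addr (opL k _ _ kr Lb) _ => //.
by apply: BL; exact: iter_comm.
Qed.

Lemma colon_mono (L L' : nat -> set V) j j' i :
  (forall i a, L i a -> L i.+1 (f r a)) -> (forall i, L i `<=` L' i) ->
  (j <= j')%N -> colon L j i `<=` colon L' j' i.
Proof.
move=> opL LL' /subnK <- x [a [Aa La] Bxa]; exists a => //; split=> //.
apply: LL'; rewrite addnCA; elim: (j' - j)%N => // k IH.
by rewrite !addSn; exact: opL.
Qed.

End Step.
End HilbertSerre.

Section Noetherian.
Variables (V : zmodType) (f : nat -> V -> V).
Hypothesis fB : forall j x y, f j (x - y) = f j x - f j y.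

(** Hilbert's basis theorem for graded modules: a submodule [L] is determined by
    the images of the [(L : x^j)] in the cokernel of the last variable [x]. *)
Lemma ascending_chain r A B : subquotient f A B -> ev_generated f r A B ->
  forall L : nat -> nat -> set V, (forall n, stable f r (L n)) ->
  (forall n i, B i `<=` L n i) -> (forall n i, L n i `<=` A i) ->
  (forall n i, L n i `<=` L n.+1 i) ->
  exists J, forall n, (J <= n)%N -> forall i, L n i `<=` L J i.
Proof.
elim: r A B => [|r IH] A B AB gen L stL BL LA LS.
  (* Without variables, generation means that [A] equals [B] in degrees above [c], so finitely many
     finite groups remain. *)
  have [c cP] := gen.
  have [J JP] : exists J, forall i, (i < c.+1)%N -> forall n, (J <= n)%N ->
      L n i `<=` L J i.
    apply: (@bounded_choice (fun i J => forall n, (J <= n)%N -> L n i `<=` L J i)).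
      move=> i; apply: (@fin_chain _ (A i) (B i) (L^~ i)) => //.
      - exact: sq_sgB AB i.
      - exact: sq_fin AB i.
      - by move=> n; exact: (stL n).1.
    move=> i J J' JJ' JP n J'n; apply: subset_trans (JP n _) _.
      exact: leq_trans J'n.
    by apply: (@chain_leq _ (L^~ i)).
  exists J => n Jn i; have [ic|ci] := ltnP i c.+1; first exact: JP.
  move=> x /LA Ax; apply: BL; case: i => // i in ci Ax *.
  by have [y ->] := cP i ci x Ax; rewrite subr0.
have AB' := subquotient_opshift fB r AB.
have {}IH := IH _ _ AB' (ev_generated_opshift gen).
have stL' n : stable f r (L n).
  by split=> [|j i a jr]; [exact: (stL n).1|apply: (stL n).2; exact: ltnW].
have opL n i a : L n i a -> L n i.+1 (f r a) by exact: (stL n).2.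
have sC0 n j i : subgrp [set a | A i a /\ L n (i + j)%N (iter j (f r) a)].
  exact: (subgrp_colon0 fB r AB j i (stL n).1).
have Lle m n i : (m <= n)%N -> L m i `<=` L n i.
  by apply: (@chain_leq _ (L^~ i)).
pose C n j i := colon f r A B (L n) j i.
have Cle m n j k i : (m <= n)%N -> (j <= k)%N -> C m j i `<=` C n k i.
  by move=> mn jk; apply: colon_mono jk; [exact: opL|move=> l; exact: Lle].
have stC n j : stable f r (C n j) by exact: (stable_colon fB AB j (BL n) (stL' n)).
have B'C n j i : opshift f r A B i `<=` C n j i by exact: sumset_r.
have CA n j i : C n j i `<=` A i.
  apply: sumset_sub; first exact: sq_sgA AB i.
    by move=> a [].
  exact: sq_sub AB' i.
(* [C n j] grows in both indices. Stability of the diagonal from [J] on settles all [j >= J]; the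
   finitely many [j < J] are treated as separate chains. *)
have [J JP] := IH (fun n => C n n) (fun n => stC n n) (fun n => B'C n n)
  (fun n => CA n n) (fun n i => Cle _ _ _ _ i (leqnSn n) (leqnSn n)).
have [K0 K0P] : exists K, forall j, (j < J)%N -> forall n, (K <= n)%N ->
    forall i, C n j i `<=` C K j i.
  apply: (@bounded_choice (fun j K => forall n, (K <= n)%N ->
    forall i, C n j i `<=` C K j i)).
    move=> j; apply: (IH (fun n => C n j) (fun n => stC n j) (fun n => B'C n j)
      (fun n => CA n j) (fun n i => Cle _ _ _ _ i (leqnSn n) (leqnn j))).
  move=> j K K' KK' KP n K'n i; apply: subset_trans (KP n _ i) _.
    exact: leq_trans K'n.
  exact: Cle.
pose K := maxn J K0.
have CK n j i : (K <= n)%N -> C n j i `<=` C K j i.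
  rewrite geq_max => /andP[Jn K0n]; have [jJ|Jj] := ltnP j J.
    apply: subset_trans (K0P j jJ n K0n i) _; apply: Cle => //.
    exact: leq_maxr.
  apply: subset_trans (Cle n (maxn n j) j (maxn n j) i _ _) _;
    rewrite ?leq_maxl ?leq_maxr //.
  apply: subset_trans (JP (maxn n j) _ i) _; first by rewrite leq_max Jn.
  by apply: Cle => //; exact: leq_maxl.
exists K => n Kn.
(* Induction on the degree [i] with the exponent [j] free: modulo [B], [a] is [b + x c] where
   [x^j b] already lies in [L K]. The element [c] has degree one less, and [x^(j+1) c] lies in
   [L n]. *)
suff cmp i j a : A i a -> L n (i + j)%N (iter j (f r) a) ->
    L K (i + j)%N (iter j (f r) a).
  by move=> i a La; have := cmp i 0%N a (LA _ _ _ La); rewrite addn0; exact.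
elim: i j a => [|i IHi] j a Aa La.
  have : C n j 0%N a by apply: sumset_l => //; exact: sq_sgB AB' _.
  move=> /(CK n j 0%N Kn)[b [Ab Lb] /= Bab].
  apply: subgrp_addr Lb _; first exact: (stL K).1.
  by rewrite -(iterB fB); apply: BL; apply: (iter_opB AB).
have : C n j i.+1 a by apply: sumset_l => //; exact: sq_sgB AB' _.
move=> /(CK n j i.+1 Kn)[b [Ab Lb] /= [_ [c Ac <-] Babc]].
have {Babc}Bj := iter_opB AB j r Babc.
rewrite !(iterB fB) -iterSr in Bj.
have Lc : L K (i + j.+1)%N (iter j.+1 (f r) c).
  apply: IHi => //; rewrite addnS -addSn.
  apply: (subgrp_subr ((stL n).1 _) _ (BL n _ _ Bj)).
  by apply: ((stL n).1 _).2 => //; exact: Lle Kn _ Lb.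
rewrite addnS -addSn in Lc.
apply: (subgrp_addr ((stL K).1 _) Lb).
exact: (subgrp_addr ((stL K).1 _) Lc (BL K _ _ Bj)).
Qed.

(** [T n] is the submodule generated by the part of [L] in degrees at most [n]. These submodules
    increase to [L], so they stop at some [J], and [L] is generated in degrees at most [J]. *)
Lemma ev_generated_sub r A B L : subquotient f A B -> ev_generated f r A B ->
  stable f r L -> (forall i, B i `<=` L i) -> (forall i, L i `<=` A i) ->
  ev_generated f r L B.
Proof.
move=> AB gen [sL opL] BL LA.
pose T n := fix T i := match i with
  | 0 => L 0%N
  | i'.+1 => if (i' < n)%N then L i else sumset (opsum f r (T i')) (B i)
  end.
have sB := sq_sgB AB.
have sT n i : subgrp (T n i).
  elim: i => [|i IH] //=; case: ifP => // _.
  by apply: subgrp_sumset => //; apply: (subgrp_opsum fB).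
have BT n i : B i `<=` T n i.
  case: i => [|i] //=; case: ifP => // _; apply: sumset_r.
  exact: (subgrp_opsum fB).
have TL n i : T n i `<=` L i.
  elim: i => [|i IH] //=; case: ifP => _; first exact: subset_refl.
  apply: sumset_sub => //; by apply: opsum_le => // j a jr /IH; exact: opL.
have TE n i : (i <= n)%N -> T n i = L i by case: i => //= i ->.
have opT n j i a : (j < r)%N -> T n i a -> T n i.+1 (f j a).
  move=> jr Ta /=; case: ifP => ni; first by apply: opL => //; exact: TL Ta.
  by apply: sumset_l => //; apply: (opsum_in fB).
have TS n i : T n i `<=` T n.+1 i.
  elim: i => [|i IH] //=; case: ifP => ni; first by rewrite ltnS (ltnW ni).
  case: ifP => ni'.
    by have := TL n i.+1; rewrite /= ni.
  move=> x [y Ty Bxy]; exists y => //; exact: opsum_sub IH _ Ty.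
have [J JP] := ascending_chain AB gen (fun n => conj (sT n) (opT n)) BT
  (fun n i => subset_trans (@TL n i) (@LA i)) TS.
exists J => i Ji x Lx.
have LJ k : L k `<=` T J k.
  have [kJ|Jk] := leqP k J; first by rewrite TE.
  by rewrite -{1}(TE k k) //; apply: JP; exact: ltnW.
have /= := LJ i.+1 x Lx; rewrite ltnNge Ji /= => -[y Ty Bxy].
by exists y => //; apply: opsum_sub Ty; exact: TL.
Qed.

End Noetherian.

(** * Discrete antiderivatives of polynomials *)

Section Antidifference.
Variable F : numFieldType.

(** Falling factorials behave under the difference operator as monomials do under the derivative;
    being monic of every degree, they allow antidifferences to be built by descent on the leading
    term. *)
Lemma antidifference_falling (k : nat) (x : F) :
  let ff j := \prod_(i < j) ('X - (i%:R)%:P) : {poly F} in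
  (ff k.+1).[x + 1] - (ff k.+1).[x] = k.+1%:R * (ff k).[x].
Proof.
move=> ff; have ffE j y : (ff j).[y] = \prod_(i < j) (y - i%:R).
  by rewrite horner_prod; apply: eq_bigr => i _; rewrite !hornerE.
rewrite !ffE big_ord_recl [X in _ - X]big_ord_recr /= subr0.
under eq_bigr => i _ do rewrite /bump leq0n add1n -natr1 opprD addrACA subrr addr0.
rewrite [X in _ - X]mulrC -mulrBl; congr (_ * _).
by rewrite opprB addrCA [x + 1]addrC addrK natr1.
Qed.

Lemma antidifference (Q : {poly F}) :
  exists P : {poly F}, forall x, P.[x + 1] - P.[x] = Q.[x].
Proof.
have [n] := ubnP (size Q); elim: n Q => // n IH Q.
have [->|Q0] := eqVneq Q 0.
  by exists 0 => x; rewrite !horner0 subrr.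
move=> sQ; pose k := (size Q).-1.
have sQk : size Q = k.+1 by rewrite prednK // size_poly_gt0.
pose ff j := \prod_(i < j) ('X - (i%:R)%:P) : {poly F}.
have sff : size (ff k) = k.+1.
  by rewrite size_prod_XsubC /index_enum -enumT size_enum_ord.
have mff : ff k \is monic by exact: monic_prod_XsubC.
pose Q' := Q - lead_coef Q *: ff k.
have sQ' : (size Q' < size Q)%N.
  rewrite sQk ltnS; apply/leq_sizeP => j; rewrite leq_eqVlt => /predU1P[<-|kj].
    rewrite coefB coefZ [X in _ * X](_ : _ = 1); last first.
      by have /monicP := mff; rewrite lead_coefE sff.
    by rewrite mulr1 lead_coefE subrr.
  by rewrite coefB coefZ !nth_default ?mulr0 ?subrr ?sff ?sQk.
have [P PQ'] := IH _ (leq_trans sQ' sQ).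
exists (P + (lead_coef Q / k.+1%:R) *: ff k.+1) => x.
rewrite !hornerD !hornerZ opprD addrACA PQ' -mulrBr antidifference_falling.
by rewrite mulrA divfK ?pnatr_eq0 // /Q' !hornerE subrK.
Qed.

End Antidifference.

Section HilbertPolynomial.
Variables (V : zmodType) (p : nat) (f : nat -> V -> V).
Hypothesis fB : forall j x y, f j (x - y) = f j x - f j y.

(** Additivity of length on the exact sequence kernel, degree [i], degree [i + 1], cokernel of the
    last variable, written without subtraction. *)
Lemma len_opker_opshift r A B i : subquotient f A B ->
  (len p (A i.+1) (B i.+1) + len p (opker f r A B i) (B i) =
   len p (A i) (B i) + len p (A i.+1) (opshift f r A B i.+1))%N.
Proof.
move=> AB; have [sA sB BA fin _ _ _] := AB.
have AB' := subquotient_opshift fB r AB.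
have KB := subquotient_opker fB r AB.
have KA : opker f r A B i `<=` A i by move=> a [].
rewrite (len_mul p (sA i) (sq_sgA KB i) (sB i) (@sq_sub _ _ _ _ KB i) (fin i)).
rewrite (len_mul p (sA i.+1) (sq_sgB AB' i.+1) (sB i.+1) _ (fin i.+1)); last first.
  exact: sub_opshift.
rewrite (setIidr KA) (setIidr (@sq_sub _ _ _ _ AB' i.+1)).
suff -> : len p (A i) (opker f r A B i) =
    len p (opshift f r A B i.+1) (B i.+1) by lia.
apply: (@len_bij _ _ _ (f r)) => //.
- exact: sq_sgA KB i.
- move=> a Aa; apply: sumset_l => //; by exists a.
- by move=> a Aa; split=> [|[]].
- by move=> x [_ [a Aa <-] Bxa]; exists a.
- by apply: fin_indexS (fin i.+1); exact: (@sq_sub _ _ _ _ AB' i.+1).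
Qed.

Theorem hilbert_serre r A B : subquotient f A B -> ev_generated f r A B ->
  exists (P : {poly rat}) (N : nat), forall n, (N <= n)%N ->
    P.[n%:R] = (\sum_(k < n) len p (A k) (B k))%:R.
Proof.
elim: r A B => [|r IH] A B AB gen.
  have [c cP] := gen; pose h n := (\sum_(k < n) len p (A k) (B k))%N.
  have len0 i : (c < i)%N -> len p (A i) (B i) = 0%N.
    case: i => // i ci; apply: len1; [exact: sq_sgA AB _|exact: sq_sgB AB _|].
    by move=> x /(cP i ci)[y ->]; rewrite subr0.
  exists ((h c.+1)%:R)%:P, c.+1 => n cn; rewrite hornerC; congr (_%:R).
  rewrite -/(h n) -(subnKC cn); elim: (n - _)%N => [|k ->]; first by rewrite addn0.
  by rewrite addnS /h [RHS]big_ord_recr /= len0 ?addn0 // addSn ltnS leq_addr.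
have AB' := subquotient_opshift fB r AB.
have KB := subquotient_opker fB r AB.
have [C [N1 CP]] := IH _ _ AB' (ev_generated_opshift gen).
have KA i : opker f r A B i `<=` A i by move=> a [].
have stK : stable f r.+1 (opker f r A B).
  by split=> [i|j i a _]; [exact: sq_sgA KB i|exact: (@sq_opA _ _ _ _ KB j i a)].
have [c cP] := ev_generated_sub fB AB gen stK (sq_sub KB) KA.
(* The last variable acts as zero on its own kernel, so the first [r] variables generate. *)
have genK : ev_generated f r (opker f r A B) B.
  exists c => i ci x /(cP i ci)[y [a [_ Ba] ya] Bxy].
  exists (y - f r a) => //; rewrite opprB addrCA.
  apply: subgrpD => //; exact: sq_sgB AB _.
have [K [N2 KP]] := IH _ _ KB genK.
(* By [lenE] below, the length in degree [n] is the cokernel sum up to [n + 1] minus the kernel sum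
   up to [n], that is [C (n + 1) - K n] for large [n]; the summed function is an antidifference up
   to a constant, fixed at [N]. *)
have [P PQ] := antidifference (C \Po ('X + 1) - K).
pose h n := (\sum_(k < n) len p (A k) (B k))%N.
have lenE n : (len p (A n) (B n) + \sum_(k < n) len p (opker f r A B k) (B k) =
    \sum_(k < n.+1) len p (A k) (opshift f r A B k))%N.
  elim: n => [|n IHn]; first by rewrite big_ord0 big_ord1 addn0.
  rewrite big_ord_recr [RHS]big_ord_recr /= -IHn.
  by rewrite addnCA len_opker_opshift // addnA [(_ + len p (A n) _)%N]addnC.
pose N := maxn N1 N2.
exists (P + ((h N)%:R - P.[N%:R])%:P), N => n Nn; rewrite hornerD hornerC.
rewrite -/(h n) -(subnKC Nn); elim: (n - N)%N => [|k IHk].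
  by rewrite addn0 subrKC.
rewrite addnS -natr1 -[P.[_ + 1]](subrK P.[(N + k)%:R]) PQ -addrA IHk.
rewrite /h big_ord_recr /= [in RHS]natrD addrC; congr (_ + _).
rewrite hornerD hornerN horner_comp !hornerE natr1 CP; last first.
  by rewrite (leq_trans (leq_maxl N1 N2)) // leqW // leq_addr.
rewrite KP; last by rewrite (leq_trans (leq_maxr N1 N2)) // leq_addr.
by rewrite -lenE natrD addrK.
Qed.

End HilbertPolynomial.

(** * Graded rings and modules *)

Lemma fin_index0 (V : zmodType) (A : set V) :
  fin_index A [set 0] <-> finite_set A.
Proof.
rewrite /fin_index (@eq_finite_set _ _ _ A) //; apply: inj_card_eq => x y _ _.
by move=> /(coset_eq _ _ (@subgrp0 V)) /= /subr0_eq ->.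
Qed.

(** An internal grading, given by its projections instead of its components: the components are the
    fixed points of the projections, and homogeneity of a subgroup becomes stability under them. *)
Record grading (V : zmodType) := Grading {
  pr :> nat -> V -> V;
  prB : forall i x y, pr i (x - y) = pr i x - pr i y;
  pr_pr : forall i j x, pr i (pr j x) = if i == j then pr j x else 0;
  pr_sum : forall x, exists n, x = \sum_(i < n) pr i x }.

Section Grading.
Variables (V : zmodType) (g : grading V).

Definition hcomp i : set V := [set x | g i x = x].
Definition below n : set V := [set x | forall i, (n <= i)%N -> g i x = 0].
Definition homog (I : set V) := forall i x, I x -> I (g i x).
Definition trunc n x := \sum_(i < n) g i x.

Let gB := @prB V g.

Lemma pr0 i : g i 0 = 0. Proof. exact: (op0 gB). Qed.
Lemma prD i x y : g i (x + y) = g i x + g i y. Proof. exact: (opD gB). Qed.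

Lemma pr_big i (I : Type) (s : seq I) (P : pred I) (F : I -> V) :
  g i (\sum_(j <- s | P j) F j) = \sum_(j <- s | P j) g i (F j).
Proof. by apply: (big_morph (g i)); [exact: prD|exact: pr0]. Qed.

Lemma subgrp_comp i : subgrp (hcomp i).
Proof. by split=> [|x y]; rewrite /hcomp /= ?pr0 // prB => -> ->. Qed.

Lemma subgrp_below n : subgrp (below n).
Proof.
split=> [i _|x y bx by_ i ni]; first exact: pr0.
by rewrite prB bx // by_ // subr0.
Qed.

Lemma comp_pr i x : hcomp i (g i x).
Proof. by rewrite /hcomp /= pr_pr eqxx. Qed.

Lemma pr_comp i j x : hcomp j x -> g i x = if i == j then x else 0.
Proof. by move=> xj; rewrite -{1}xj pr_pr xj. Qed.

Lemma comp_below i n x : (i < n)%N -> hcomp i x -> below n x.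
Proof.
move=> lt_in xi j nj; rewrite (pr_comp j xi) gtn_eqF //.
exact: leq_trans nj.
Qed.

Lemma leq_below m n : (m <= n)%N -> below m `<=` below n.
Proof. by move=> mn x mx i ni; apply: mx; exact: leq_trans ni. Qed.

Lemma pr_trunc i n x : g i (trunc n x) = if (i < n)%N then g i x else 0.
Proof.
rewrite pr_big; case: ifP => [lt_in|ni].
  rewrite (bigD1 (Ordinal lt_in)) //= pr_pr eqxx big1 ?addr0 // => j ji.
  by rewrite pr_pr; case: eqP => // e; case/eqP: ji; exact: val_inj.
rewrite big1 // => j _; rewrite pr_pr; case: eqP => // e.
by rewrite e ltn_ord in ni.
Qed.

Lemma below_trunc n x : below n (trunc n x).
Proof. by move=> i ni; rewrite pr_trunc ltnNge ni. Qed.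

Lemma ex_below x : exists n, below n x.
Proof. by have [n xE] := pr_sum g x; exists n; rewrite xE; exact: below_trunc. Qed.

Lemma pr_eq0 x : (forall i, g i x = 0) -> x = 0.
Proof. by move=> x0; have [n ->] := pr_sum g x; rewrite big1. Qed.

Lemma pr_eq x y : (forall i, g i x = g i y) -> x = y.
Proof.
by move=> xy; apply: subr0_eq; apply: pr_eq0 => i; rewrite prB xy subrr.
Qed.

Lemma truncE n x : below n x -> trunc n x = x.
Proof.
by move=> xn; apply: pr_eq => i; rewrite pr_trunc; case: ltnP => // /xn ->.
Qed.

Lemma subgrp_homog_ind (T : set V) : subgrp T ->
  (forall i x, hcomp i x -> T x) -> forall x, T x.
Proof.
move=> sT cT x; have [n ->] := pr_sum g x; apply: subgrp_sum => // i _.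
by apply: cT; exact: comp_pr.
Qed.

Lemma homog_sub (I J : set V) : homog I -> subgrp J ->
  (forall i x, hcomp i x -> I x -> J x) -> I `<=` J.
Proof.
move=> hI sJ IJ x Ix; have [n ->] := pr_sum g x; apply: subgrp_sum => // i _.
by apply: IJ (comp_pr i x) _; exact: hI.
Qed.

Lemma homogP (I : set V) x : subgrp I -> (forall i, I (g i x)) -> I x.
Proof.
by move=> sI Ix; have [n ->] := pr_sum g x; exact: subgrp_sum.
Qed.

Lemma cosets_below n : cosets (below n.+1) (below n) #= cosets (hcomp n) [set 0].
Proof.
apply: (@index_bij _ _ (g n)).
- exact: subgrp_below.
- exact: subgrp_below.
- exact: subgrp0.
- by move=> x y _ _; exact: prB.
- by move=> x _; exact: comp_pr.
- move=> x xn; split=> /= [x0 i|]; last by apply.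
  by rewrite leq_eqVlt => /predU1P[<-//|]; exact: xn.
- move=> x xn; exists x; first exact: comp_below xn.
  by rewrite /= xn subrr.
Qed.

Hypothesis fin : forall i, finite_set (hcomp i).

Lemma fin_below n : fin_index (below n) [set 0].
Proof.
elim: n => [|n IH].
  apply/fin_index0; apply: (@sub_finite_set _ _ [set 0]); last exact: finite_set1.
  by move=> x x0; apply: pr_eq0 => i; exact: x0.
have [] := @index_mul _ (below n.+1) (below n) [set 0]; try exact: subgrp_below.
- exact: subgrp0.
- by move=> _ ->; exact: (subgrp_below n).1.
- by rewrite /fin_index (eq_finite_set (cosets_below n)); exact/fin_index0.
- by apply: fin_indexS IH => x [].
by [].
Qed.

Lemma len_below p n :
  len p (below n) [set 0] = (\sum_(k < n) len p (hcomp k) [set 0%R])%N.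
Proof.
elim: n => [|n IH].
  rewrite big_ord0 len1 //; [exact: subgrp_below|exact: subgrp0|].
  by move=> x x0; apply: pr_eq0 => i; exact: x0.
rewrite big_ord_recr /= -IH addnC.
rewrite (@len_mul p _ (below n.+1) (below n) [set 0]); first last.
- exact: fin_below.
- by move=> _ ->; exact: (subgrp_below n).1.
- exact: subgrp0.
- exact: subgrp_below.
- exact: subgrp_below.
rewrite setIidr; last exact: leq_below.
congr (_ + _)%N; rewrite /len; congr (logn p _).
by apply: (index_eq _ (cosets_below n)).2; exact/fin_index0.
Qed.

End Grading.

Section GradedPairing.
Variables (U V : zmodType) (op : U -> V -> V).
Variables (gU : grading U) (gV : grading V).
Hypothesis opDl : forall a b x, op (a + b) x = op a x + op b x.
Hypothesis opDr : forall a x y, op a (x + y) = op a x + op a y.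
Hypothesis opM : forall i j a x,
  hcomp gU i a -> hcomp gV j x -> hcomp gV (i + j) (op a x).

Lemma opBl a b x : op (a - b) x = op a x - op b x.
Proof. by rewrite opDl (biaddNl opDl). Qed.

Lemma opBr a x y : op a (x - y) = op a x - op a y.
Proof. by rewrite opDr (biaddNr opDr). Qed.

Lemma pr_opl i k a x : hcomp gU i a ->
  gV k (op a x) = if (i <= k)%N then op a (gV (k - i)%N x) else 0.
Proof.
move=> ai; move: x; apply: (subgrp_homog_ind (g := gV)) => [|j x xj].
  split=> [|x y /= Tx Ty] /=; first by rewrite pr0 (biadd0r opDr) pr0 if_same.
  rewrite !opBr !prB Tx Ty.
  by case: ifP; rewrite ?subrr // opBr.
rewrite (pr_comp k (opM ai xj)); case: leqP => ik.
  rewrite (pr_comp _ xj) (_ : (k - i == j)%N = (k == i + j)%N); last by lia.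
  by case: ifP => // _; rewrite (biadd0r opDr).
by rewrite ltn_eqF //; exact: ltn_addr.
Qed.

Lemma pr_opr j k a x : hcomp gV j x ->
  gV k (op a x) = if (j <= k)%N then op (gU (k - j)%N a) x else 0.
Proof.
move=> xj; move: a; apply: (subgrp_homog_ind (g := gU)) => [|i a ai].
  split=> [|a b /= Ta Tb] /=; first by rewrite pr0 (biadd0l opDl) pr0 if_same.
  rewrite !opBl !prB Ta Tb.
  by case: ifP; rewrite ?subrr // opBl.
rewrite (pr_comp k (opM ai xj)) addnC; case: leqP => jk.
  rewrite (pr_comp _ ai) (_ : (k - j == i)%N = (k == j + i)%N); last by lia.
  by case: ifP => // _; rewrite (biadd0l opDl).
by rewrite ltn_eqF //; exact: ltn_addr.
Qed.

Lemma pr_op k a x :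
  gV k (op a x) = \sum_(l < k.+1) op (gU l a) (gV (k - l)%N x).
Proof.
move: a; apply: (subgrp_homog_ind (g := gU)) => [|i a ai].
  split=> /= [|a b Ta Tb].
    rewrite (biadd0l opDl) pr0 big1 // => l _; rewrite pr0.
    exact: (biadd0l opDl).
  by rewrite opBl prB Ta Tb -sumrB; apply: eq_bigr => l _; rewrite prB opBl.
rewrite /= (pr_opl k x ai); case: leqP => ik.
  rewrite (bigD1 (Ordinal (ik : (i < k.+1)%N))) //= (pr_comp _ ai) eqxx.
  rewrite big1 ?addr0 // => l li; rewrite (pr_comp _ ai); case: eqP => [e|_].
    by case/eqP: li; exact: val_inj.
  exact: (biadd0l opDl).
rewrite big1 // => l _; rewrite (pr_comp _ ai); case: eqP => [e|_].
  by have := ltn_ord l; rewrite e ltnS leqNgt ik.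
exact: (biadd0l opDl).
Qed.

Lemma below_op m n a x :
  below gU m a -> below gV n x -> below gV (n + m) (op a x).
Proof.
move=> am xn; rewrite -(truncE am) /trunc.
have -> : op (\sum_(i < m) gU i a) x = \sum_(i < m) op (gU i a) x.
  by apply: (big_morph (op^~ x)) => [b c|]; [exact: opDl|exact: (biadd0l opDl)].
apply: subgrp_sum => [|i _ k nk]; first exact: subgrp_below.
rewrite (pr_opl _ _ (comp_pr gU i a)); case: ifP => // ik.
by rewrite xn ?(biadd0r opDr) //; have := ltn_ord i; lia.
Qed.

End GradedPairing.

(** An algebra over a finite field in degree 0, generated by finitely many elements of degree 1. The
    field [std_dvd] makes the degree-zero part have positive length, without which [len p] could
    vanish identically. *)
Record standard_graded (p : nat) (S : naRingType) (g : grading S) := StandardGraded {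
  std_comm : na_commutative_ring S;
  std_mul : forall i j a b, hcomp g i a -> hcomp g j b -> hcomp g (i + j) (a ** b);
  std_one : hcomp g 0 naone;
  std_fin : finite_set (hcomp g 0);
  std_field : forall a, hcomp g 0 a -> a <> 0 -> exists b, a ** b = naone;
  std_prime : prime p;
  std_dvd : (p %| sgindex (hcomp g 0) [set 0%R])%N;
  std_rank : nat;
  std_gen : nat -> S;
  std_gen1 : forall j, hcomp g 1 (std_gen j);
  std_span : forall i a, hcomp g i.+1 a ->
    opsum (fun j => namul (std_gen j)) std_rank (hcomp g i) a }.

Lemma finite_opsum (V : zmodType) (f : nat -> V -> V) r (A : set V) :
  finite_set A -> finite_set (opsum f r A).
Proof.
move=> finA; elim: r => [|r IH] /=; first exact: finite_set1.
apply: sub_finite_set (finite_image2 (fun a b => f r a + b) finA IH).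
by move=> y [a Aa ya]; exists a => //; exists (y - f r a) => //; rewrite subrKC.
Qed.

(** * Ideals of a standard graded algebra and their Hilbert functions *)

Section GradedRing.
Variables (p : nat) (S : naRingType) (g : grading S).
Hypothesis std : standard_graded p g.

Let mulDl := @namulDl S.
Let mulDr := @namulDr S.
Let mulM := std_mul std.
Let mulC := (std_comm std).1.
Let mulA := (std_comm std).2.
Let mulB (a x y : S) : a ** (x - y) = a ** x - a ** y := opBr mulDr a x y.
Let mul0 (a : S) : a ** 0 = 0 := biadd0r mulDr a.

Lemma finite_comp i : finite_set (hcomp g i).
Proof.
elim: i => [|i IH]; first exact: (std_fin std).
by apply: sub_finite_set (finite_opsum _ _ IH) => a; exact: (std_span std).
Qed.

Lemma fin_below_sub n I : subgrp I -> fin_index (below g n) I.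
Proof.
move=> sI; apply: (fin_indexl sI (@subgrp0 _) _ (fin_below finite_comp n)).
by move=> _ ->; exact: sI.1.
Qed.

Definition ideal (I : set S) := subgrp I /\ forall a x, I x -> I (a ** x).

(** The length of the image of degrees [< n] in [S / I]. It is used for inhomogeneous primes too,
    where no degree-by-degree Hilbert function exists. *)
Definition hilb (I : set S) n := len p (below g n) I.

Lemma leq_hilb (I J : set S) m n : subgrp I -> subgrp J -> (m <= n)%N ->
  J `<=` I -> (hilb I m <= hilb J n)%N.
Proof.
move=> sI sJ mn JI; apply: (@leq_trans (hilb I n)).
  apply: (@len_inj _ _ _ id); try exact: subgrp_below; try by [].
    exact: leq_below.
  exact: fin_below_sub.
apply: (@len_surj _ _ _ id); try exact: subgrp_below; try by [].
- by move=> a _; exact: JI.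
- by move=> x xn; exists x; rewrite ?subrr //; exact: sI.1.
- exact: fin_below_sub.
Qed.

Section Quotient.
Variables (I : set S) (a : S).
Hypothesis idI : ideal I.

Definition adjoin : set S := [set y | exists s, I (y - a ** s)].
Definition colon_ideal : set S := [set s | I (a ** s)].

Lemma ideal_adjoin : ideal adjoin.
Proof.
split; first split=> [|x y [s Is] [t It]].
- by exists 0; rewrite mul0 subr0; exact: idI.1.1.
- by exists (s - t); rewrite mulB subrACA; exact: idI.1.2.
- by move=> b x [s Is]; exists (b ** s); rewrite mulA [a ** b]mulC -mulA -mulB;
    exact: idI.2.
Qed.

Lemma ideal_colon : ideal colon_ideal.
Proof.
split; first split=> [|x y Ix Iy]; rewrite /colon_ideal /=.
- by rewrite mul0; exact: idI.1.1.
- by rewrite mulB; exact: idI.1.2.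
- by move=> b x Ix; rewrite mulA [a ** b]mulC -mulA; exact: idI.2.
Qed.

Lemma sub_adjoin : I `<=` adjoin.
Proof. by move=> x Ix; exists 0; rewrite mul0 subr0. Qed.

Lemma adjoin_in : adjoin a.
Proof. by exists naone; rewrite namul1r subrr; exact: idI.1.1. Qed.

Hypothesis homI : homog g I.
Variable e : nat.
Hypothesis ae : hcomp g e a.

Let prM k x : g k (a ** x) = if (e <= k)%N then a ** g (k - e)%N x else 0.
Proof. exact: (pr_opl mulDr mulM k x ae). Qed.

Lemma homog_colon : homog g colon_ideal.
Proof.
move=> i x Ix; have := homI (i + e)%N Ix.
by rewrite prM leq_addl addnK.
Qed.

Lemma homog_adjoin : homog g adjoin.
Proof.
move=> i x [s Is]; have := homI i Is; rewrite prB prM.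
by case: ifP => _ Ii; [exists (g (i - e)%N s)|exists 0; rewrite mul0].
Qed.

(** From the exact sequence [0 -> S / (I : a) -> S / I -> S / (I + a S) -> 0] *)
Lemma hilb_split m : (e <= m)%N ->
  (hilb I m <= hilb adjoin m + hilb colon_ideal (m - e))%N.
Proof.
move=> em; have [sI _] := idI; have [sJ _] := ideal_adjoin.
have [sK _] := ideal_colon; have sm := @subgrp_below _ g.
rewrite /hilb (len_mul p (sm m) sJ sI sub_adjoin (fin_below_sub m sI)).
rewrite leq_add2l.
pose W := [set y | exists2 s, below g (m - e) s & I (y - a ** s)].
have sW : subgrp W.
  split=> [|x y [s bs Is] [t bt It]].
    by exists 0; [exact: (sm _).1|rewrite mul0 subr0; exact: sI.1].
  exists (s - t); first exact: (sm _).2.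
  by rewrite mulB subrACA; exact: sI.2.
have WP s : below g (m - e) s -> W (a ** s).
  by move=> bs; exists s => //; rewrite subrr; exact: sI.1.
have surjW y : W y -> exists2 s, below g (m - e) s & I (y - a ** s) by [].
have aB s t : below g (m - e) s -> below g (m - e) t ->
    a ** (s - t) = a ** s - a ** t by [].
have [finW _] := @index_surj _ _ (namul a) (below g (m - e)) colon_ideal W I
  (sm _) sK sI aB WP (fun s _ Is => Is) surjW (fin_below_sub (m - e) sK).
apply: leq_trans (len_surj p (sm _) sK sI aB WP (fun s _ Is => Is) surjW
  (fin_below_sub (m - e) sK)).
apply: (@len_inj _ _ _ id) => //; first exact: subgrpI.
(* As [a] is homogeneous of degree [e] and [I] is homogeneous, the components of [s] in degrees
   [>= m - e] only affect [a ** s] in degrees [>= m], where [y] vanishes; they may be dropped. *)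
move=> y [ym [s Is]]; exists (trunc g (m - e) s); first exact: below_trunc.
apply: (homogP (g := g)) => // k; rewrite prB prM.
have := homI k Is; rewrite prB prM; case: leqP => // ek; rewrite pr_trunc.
by case: ltnP => // mk _; rewrite ym ?mul0 ?subrr; [exact: sI.1|lia].
Qed.

End Quotient.

(** [S] is a finitely generated graded module over the polynomial ring on its degree-one generators,
    and homogeneous ideals are graded submodules. *)
Lemma ideal_chain (K : nat -> set S) : (forall n, ideal (K n)) ->
  (forall n, homog g (K n)) -> (forall n, K n `<=` K n.+1) ->
  exists J, forall n, (J <= n)%N -> K n `<=` K J.
Proof.
move=> idK homK KS; pose f j x := std_gen std j ** x.
have fB j x y : f j (x - y) = f j x - f j y by exact: mulB.
have sq : subquotient f (hcomp g) (fun=> [set 0]).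
  split=> //.
  - by move=> i; exact: subgrp_comp.
  - by move=> i; exact: subgrp0.
  - by move=> i _ ->; exact: (subgrp_comp g i).1.
  - by move=> i; apply/fin_index0; exact: finite_comp.
  - by move=> j i a ai; have := mulM (std_gen1 std j) ai.
  - by move=> j i _ ->; exact: mul0.
  - by move=> j k i a _; rewrite /f /= !mulA [X in X ** a - _]mulC subrr.
have gen : ev_generated f (std_rank std) (hcomp g) (fun=> [set 0]).
  exists 0%N => i _ x /(std_span std) sx; exists x => //=.
  by rewrite subrr.
have stL n : stable f (std_rank std) (fun i => hcomp g i `&` K n).
  split=> [i|j i a _ [ai Ka]]; first exact: subgrpI (subgrp_comp g i) (idK n).1.
  by split; [exact: (mulM (std_gen1 std j) ai)|exact: (idK n).2].
have [J JP] := ascending_chain fB sq gen stL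
  (fun n i _ e => conj (eq_ind_r (hcomp g i) (subgrp_comp g i).1 e)
                       (eq_ind_r (K n) (idK n).1.1 e))
  (fun n i x => @proj1 _ _) (fun n i x Kx => conj Kx.1 (KS n x Kx.2)).
exists J => n Jn; apply: (homog_sub (homK n)) => [|i x xi Kx].
  exact: (idK J).1.
by have [] := JP n Jn i x (conj xi Kx).
Qed.

(** If no ideal with [Q] above [I0] were maximal, choice would produce a strictly increasing
    sequence of homogeneous ideals. *)
Lemma max_ideal_exists (Q : set S -> Prop) (I0 : set S) :
  ideal I0 -> homog g I0 -> Q I0 ->
  exists I, [/\ ideal I, homog g I, Q I, I0 `<=` I &
    forall J, ideal J -> homog g J -> I `<=` J -> Q J -> J `<=` I].
Proof.
move=> id0 hom0 Q0; apply: contrapT => noI.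
pose T := {I : set S | [/\ ideal I, homog g I, Q I & I0 `<=` I]}.
have next (I : T) : exists J : T, sval I `<=` sval J /\ ~ (sval J `<=` sval I).
  apply: contrapT => noJ; apply: noI; case: I noJ => I [idI homI QI II] /= noJ.
  exists I; split=> // J idJ homJ IJ QJ; apply: contrapT => JI; apply: noJ.
  have JP : [/\ ideal J, homog g J, Q J & I0 `<=` J].
    by split=> //; exact: subset_trans II IJ.
  by exists (exist _ J JP).
have [nx nxP] := choice next.
pose K n := iter n nx (exist _ I0 (And4 id0 hom0 Q0 (@subset_refl _ I0))).
have [|||J JP] := @ideal_chain (fun n => sval (K n)).
- by move=> n; case: (svalP (K n)).
- by move=> n; case: (svalP (K n)).
- by move=> n; exact: (nxP (K n)).1.
by case: (nxP (K J)) => _; apply; exact: (JP J.+1).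
Qed.

(** The growth condition [h n = o(n ^ d)] *)
Definition small d (h : nat -> nat) :=
  forall k, exists N, forall n, (N <= n)%N -> (k * h n <= n ^ d)%N.

Lemma small_add d (h h1 h2 : nat -> nat) e : small d h1 -> small d h2 ->
  (forall n, (e <= n)%N -> (h n <= h1 n + h2 n)%N) -> small d h.
Proof.
move=> s1 s2 hE k; have [N1 P1] := s1 (2 * k)%N; have [N2 P2] := s2 (2 * k)%N.
exists (maxn e (maxn N1 N2)) => n; rewrite !geq_max => /and3P[en N1n N2n].
have := leq_mul (leqnn (2 * k)) (hE n en); rewrite mulnDr.
have := P1 n N1n; have := P2 n N2n; rewrite -!mulnA; lia.
Qed.

Lemma small_sum d (h h1 : nat -> nat) : small d h1 ->
  (forall n, (h n.+1 <= h1 n.+1 + h n)%N) -> small d.+1 h.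
Proof.
move=> s1 hE k; have [N NP] := s1 (2 * k)%N.
have bound n : (2 * k * h (N + n) <= 2 * k * h N + n * (N + n) ^ d)%N.
  elim: n => [|n IH]; first by rewrite addn0 leq_addr.
  rewrite addnS; apply: leq_trans (leq_mul (leqnn _) (hE _)) _; rewrite mulnDr.
  apply: leq_trans (leq_add (NP _ _) IH) _; first by rewrite -addnS leq_addr.
  have mono a b : (a <= b)%N -> (a ^ d <= b ^ d)%N.
    by case: (d) => // e; rewrite leq_exp2r.
  rewrite addnCA leq_add2l mulSn leq_add2l leq_mul2l; apply/orP; right.
  exact: mono.
(* Beyond this threshold the constant [2 k h N] is at most [n^(d+1)], as is the accumulated sum; the
   factor 2 pays for the two terms. *)
exists (maxn N (2 * k * h N)) => n; rewrite geq_max => /andP[Nn hn].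
have := bound (n - N)%N; rewrite subnKC // => bn.
have n1 : (2 * k * h N <= n ^ d.+1)%N.
  apply: leq_trans hn _; case: (n) => // l; rewrite expnS leq_pmulr //.
  by rewrite expn_gt0.
have n2 : ((n - N) * n ^ d <= n ^ d.+1)%N.
  by rewrite expnS leq_mul2r leq_subr orbT.
by rewrite -!mulnA in bn n1 *; lia.
Qed.

End GradedRing.

(** * Chains of primes and growth of Hilbert functions *)

Section PrimeChains.
Variables (p : nat) (S : naRingType) (g : grading S).
Hypothesis std : standard_graded p g.

Let mulDl := @namulDl S.
Let mulDr := @namulDr S.
Let mulM := std_mul std.
Let mulC := (std_comm std).1.
Let mulA := (std_comm std).2.
Let sm := @subgrp_below _ g.

Definition prime_set (P : set S) :=
  [/\ ideal P, ~ P naone & forall x y, P (x ** y) -> P x \/ P y].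

Lemma least_notin (I : set S) x : subgrp I -> ~ I x ->
  exists i, ~ I (g i x) /\ forall l, (l < i)%N -> I (g l x).
Proof.
move=> sI Ix; have exi : exists i, `[< ~ I (g i x) >].
  apply: contrapT => no; apply: Ix; apply: (homogP (g := g)) => // i.
  by apply: contrapT => Ii; apply: no; exists i; apply/asboolP.
exists (ex_minn exi); case: ex_minnP => i /asboolP Ii min; split=> // l li.
by apply: contrapT => Il; have := min l (asboolT Il); rewrite leqNgt li.
Qed.

(** If [x] and [y] are outside [I], take their lowest components outside [I], in degrees [i] and
    [j]. Modulo [I], the component of [x y] in degree [i + j] is the product of these two. *)
Lemma homog_prime (I : set S) : ideal I -> homog g I -> ~ I naone ->
  (forall i j a b, hcomp g i a -> hcomp g j b -> I (a ** b) -> I a \/ I b) ->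
  prime_set I.
Proof.
move=> [sI mI] homI I1 pI; split=> // x y Ixy.
apply: contrapT => /not_orP[Ix Iy].
have [i [Ii ltI]] := least_notin sI Ix; have [j [Ij ltJ]] := least_notin sI Iy.
have := homI (i + j)%N _ Ixy; rewrite (pr_op mulDl mulDr mulM).
have ij : (i < (i + j).+1)%N by rewrite ltnS leq_addr.
rewrite (bigD1 (Ordinal ij)) //= addKn => Isum.
have /pI : I (g i x ** g j y).
  apply: subgrp_subr Isum _ => //; rewrite addrAC subrr add0r.
  apply: subgrp_sum => // l li.
  have [lt_li|le_il] := ltnP l i; first by rewrite mulC; apply: mI; exact: ltI.
  apply: mI; apply: ltJ; have := ltn_ord l.
  have : val l != i by apply: contraNneq li => e; apply/eqP/val_inj.
  by move=> /=; lia.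
by move=> /(_ i j (comp_pr g i x) (comp_pr g j y)) [].
Qed.

Lemma hilb_eq0 (I : set S) n : ideal I -> I naone -> hilb p g I n = 0%N.
Proof.
move=> [sI mI] I1; apply: len1 => // x _; rewrite -(namul1r x); exact: mI.
Qed.

(** For homogeneous [a], [b] outside [I] with [a b] in [I], both [I + a S] and [(I : a)] are
    strictly larger than [I], the latter by [b]. By maximality both are small, and [hilb_split] then
    makes [I] small. *)
Lemma max_prime d (I : set S) : ideal I -> homog g I -> ~ small d (hilb p g I) ->
  (forall J, ideal J -> homog g J -> I `<=` J ->
    ~ small d (hilb p g J) -> J `<=` I) ->
  prime_set I.
Proof.
move=> idI homI nI maxI; apply: homog_prime => //.
  by move=> I1; apply: nI => k; exists 0%N => n _; rewrite hilb_eq0 ?muln0.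
move=> i j a b ai bj Iab; apply: contrapT => /not_orP[Ia Ib].
apply: nI; apply: (small_add (e := i) (h1 := hilb p g (adjoin I a))
  (h2 := hilb p g (colon_ideal I a))) => [||n ni].
- apply: contrapT => nJ; apply: Ia.
  apply: (maxI (adjoin I a)) => //; last exact: adjoin_in.
  + exact: (ideal_adjoin std).
  + exact: (homog_adjoin std homI ai).
  + exact: sub_adjoin.
- apply: contrapT => nJ; apply: Ib.
  apply: (maxI (colon_ideal I a)) => //.
  + exact: (ideal_colon std).
  + exact: (homog_colon std homI ai).
  + by move=> x Ix; exact: idI.2.
apply: leq_trans (hilb_split std idI homI ai ni) _; rewrite leq_add2l.
have sK := (ideal_colon std a idI).1.
by apply: (leq_hilb std) => //; exact: leq_subr.
Qed.

Lemma sub_comp1 (I : set S) : ideal I -> hcomp g 1 `<=` I ->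
  forall i, (0 < i)%N -> hcomp g i `<=` I.
Proof.
move=> [sI mI] I1 [//|i] _ x /(std_span std) sx.
apply: (opsum_le sI) sx => j a _ _; rewrite mulC.
by apply: mI; apply: I1; exact: std_gen1.
Qed.

(** Such an ideal contains all positive degrees, so the quotient lives in degree 0 and [hilb] is
    bounded. *)
Lemma small_comp1 (I : set S) d : ideal I -> hcomp g 1 `<=` I ->
  small d.+1 (hilb p g I).
Proof.
move=> idI I1; have sub := sub_comp1 idI I1; have [sI mI] := idI.
have bound n : (hilb p g I n.+1 <= hilb p g I 1)%N.
  apply: (@len_surj _ _ _ id) => //; first exact: leq_below.
    move=> x _; exists (g 0 x); first exact: comp_below (comp_pr g 0 x).
    apply: (homogP (g := g)) => // i; rewrite prB pr_pr; case: i => [|i] /=.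
      by rewrite subrr; exact: sI.1.
    by rewrite subr0; apply: (sub i.+1) => //; exact: comp_pr.
  exact: (fin_below_sub std).
move=> k; exists (k * hilb p g I 1).+1%N => -[//|n] kn.
apply: leq_trans (leq_mul (leqnn k) (bound n)) _.
by apply: leq_trans (ltnW kn) _; rewrite expnS leq_pmulr // expn_gt0.
Qed.

Lemma prime_chain_exists d (I : set S) : ideal I -> homog g I ->
  ~ small d (hilb p g I) ->
  exists P : nat -> set S,
    (forall i, (i <= d)%N -> prime_set (P i) /\ I `<=` P i) /\
    (forall i, (i < d)%N -> P i `<=` P i.+1 /\ ~ (P i.+1 `<=` P i)).
Proof.
elim: d I => [|d IH] I idI homI nI.
  have [P [idP homP nP IP maxP]] := max_ideal_exists std
    (Q := fun J => ~ small 0 (hilb p g J)) idI homI nI.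
  by exists (fun=> P); split=> // i _; split=> //; exact: max_prime maxP.
have [P [idP homP nP IP maxP]] := max_ideal_exists std
  (Q := fun J => ~ small d.+1 (hilb p g J)) idI homI nI.
have primeP := max_prime idP homP nP maxP.
have [x [x1 Px]] : exists x, hcomp g 1 x /\ ~ P x.
  apply: contrapT => no; apply: nP; apply: small_comp1 => // x x1.
  by apply: contrapT => Px; apply: no; exists x.
have colonP : colon_ideal P x `<=` P by move=> s; case: primeP => _ _ /[apply] -[].
have idQ := ideal_adjoin std x idP; have homQ := homog_adjoin std homP x1.
(* Since [(P : x)] contains [P] and [x] has degree 1, [hilb P (n + 1)] exceeds [hilb P n] by at most
   [hilb (P + x S) (n + 1)]. Summation would make [P] small of order [d + 1]. *)
have nQ : ~ small d (hilb p g (adjoin P x)).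
  move=> sQ; apply: nP; apply: small_sum sQ _ => n.
  have := hilb_split std idP homP x1 (ltn0Sn n); rewrite subSS subn0.
  move=> /leq_trans; apply; rewrite leq_add2l.
  apply: (leq_hilb std) => //; [exact: (ideal_colon std x idP).1|exact: idP.1|].
  by move=> s Ps; exact: idP.2.
have [C [CP CS]] := IH _ idQ homQ nQ.
exists (fun i => if i is i'.+1 then C i' else P); split=> [[|i] id|[|i] id].
- by [].
- have [prC QC] := CP i id; split=> //; apply: subset_trans QC.
  by apply: subset_trans IP _; exact: sub_adjoin.
- have [_ QC] := CP 0%N (leq0n d); split.
    by apply: subset_trans QC; exact: sub_adjoin.
  by move=> CP0; apply: Px; apply: CP0; apply: QC; exact: adjoin_in.
- exact: CS.
Qed.

Lemma hilb_prime_step (P Q : set S) : prime_set P -> prime_set Q ->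
  P `<=` Q -> ~ (Q `<=` P) -> exists e, forall e' n, (e <= e')%N ->
  (hilb p g P n + hilb p g Q n <= hilb p g P (n + e'))%N.
Proof.
move=> [[sP mP] _ pP] [[sQ mQ] _ _] PQ QP.
have [f [Qf Pf]] : exists f, Q f /\ ~ P f.
  apply: contrapT => no; apply: QP => f Qf; apply: contrapT => Pf.
  by apply: no; exists f.
(* [f] is not assumed homogeneous; all its components have degree below [e]. Multiplication by [f]
   embeds [S / P] into [Q / P] because [P] is prime. *)
have [e fe] := ex_below g f; exists e => e' n ee'.
rewrite [X in (_ <= X)%N]/hilb (len_mul p (sm _) sQ sP PQ); last first.
  exact: (fin_below_sub std).
rewrite addnC; apply: leq_add; first by apply: (leq_hilb std) => //; exact: leq_addr.
apply: (@len_inj _ _ _ (namul f)) => //.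
- exact: subgrpI.
- by move=> x y _ _; exact: (opBr mulDr).
- move=> a an; split; last by rewrite mulC; exact: mQ.
  by apply: (below_op mulDl mulDr mulM) => //; exact: leq_below fe.
- by move=> a _; split=> [/pP[]|/mP].
- by apply: fin_indexS (fin_below_sub std (n + e') sP) => x [].
Qed.

(** Each strict inclusion adds a copy of the growth of the next prime at every shift by a fixed
    amount; about [n] shifts raise the order by one. The constant [c] inside the argument absorbs
    the shifts. *)
Lemma prime_chain_hilb r (P : nat -> set S) :
  (forall i, (i <= r)%N -> prime_set (P i)) ->
  (forall i, (i < r)%N -> P i `<=` P i.+1 /\ ~ (P i.+1 `<=` P i)) ->
  exists2 c, (0 < c)%N &
    forall n, (0 < n)%N -> (n ^ r <= c * hilb p g (P 0%N) (c * n))%N.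
Proof.
elim: r P => [|r IH] P primeP PS.
  exists 1%N => // n n0; rewrite expn0 !mul1n.
  have [[sP mP] P1 _] := primeP 0%N (leqnn _).
  (* Nonzero elements of degree 0 are units, so the degree-zero field embeds in [S / P]; its length
     is at least 1 because [p] divides its order. *)
  apply: (@leq_trans (len p (hcomp g 0) [set 0%R])).
    rewrite /len logn_gt0 mem_primes (std_prime std) (std_dvd std) andbT /=.
    apply: index_gt0; last exact: subgrp_comp.
    by apply/fin_index0; exact: (std_fin std).
  apply: (@len_inj _ _ _ id) => //; [exact: subgrp_comp|exact: subgrp0| | |].
  - by move=> a a0; exact: comp_below a0.
  - move=> a a0; split=> [Pa|->]; last exact: sP.1.
    apply: contrapT => an0; have [b ab] := std_field std a0 an0.
    by apply: P1; rewrite -ab mulC; exact: mP.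
  - exact: (fin_below_sub std).
have [c c0 cP] := IH (fun i => P i.+1) (fun i => primeP i.+1) (fun i => PS i.+1).
have [P01 P10] := PS 0%N (ltn0Sn r).
have [e eP] :=
  hilb_prime_step (primeP 0%N (leq0n _)) (primeP 1%N (ltn0Sn r)) P01 P10.
(* At least [e], so a legitimate shift, and a multiple of [c], so that the induction hypothesis
   applies at [E (n + k)]. Taking [k = n] below explains the constant [2 E]. *)
pose E := (c * e.+1)%N.
have eE : (e <= E)%N by rewrite /E; nia.
have bound n k : (0 < n)%N -> (k * n ^ r <= c * hilb p g (P 0%N) (E * (n + k)))%N.
  move=> n0; elim: k => // k IHk; rewrite addnS mulnS addnC.
  apply: leq_trans (leq_mul (leqnn c) (eP E _ eE)); rewrite mulnDr mulSn addnC.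
  apply: leq_add; first exact: IHk.
  rewrite /E -mulnA; apply: leq_trans (cP _ _); last by rewrite muln_gt0 addn_gt0 n0.
  have nn : (n <= e.+1 * (n + k))%N by nia.
  by case: (r) => // l; rewrite leq_exp2r.
exists (E * 2)%N; first by rewrite /E; lia.
move=> n n0; rewrite expnS; apply: leq_trans (bound n n n0) _.
rewrite addnn -mul2n mulnA leq_mul2r; apply/orP; right; rewrite /E; nia.
Qed.

End PrimeChains.

(** * Krull dimension *)

Section PolynomialGrowth.
Variable F : archiRealFieldType.
Implicit Type P : {poly F}.

(** The terms below degree [d] are [O(x^(d-1))]; multiplying by [x] includes [d = 0]. Allowing [d]
    above the degree, with coefficient 0, is needed for the limit. *)
Lemma poly_coef_bound P d : (size P <= d.+1)%N ->
  exists2 C : F, 0 <= C & forall x, 1 <= x ->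
    x * `|P.[x] - P`_d * x ^+ d| <= C * x ^+ d.
Proof.
move=> sP; exists (\sum_(i < d) `|P`_i|) => [|x x1]; first exact: sumr_ge0.
have x0 : 0 <= x by exact: le_trans x1.
rewrite (horner_coef_wide _ sP) big_ord_recr /= addrK mulr_suml.
apply: (@le_trans _ _ (x * \sum_(i < d) `|P`_i| * x ^+ d.-1)).
  rewrite ler_wpM2l //; apply: le_trans (ler_norm_sum _ _ _) _.
  apply: ler_sum => i _; rewrite normrM normrX (ger0_norm x0) ler_wpM2l //.
  by apply: ler_weXn2l => //; have := ltn_ord i; lia.
rewrite mulr_sumr; apply: ler_sum => i _.
by rewrite mulrCA -exprS prednK //; exact: leq_ltn_trans (ltn_ord i).
Qed.

Lemma poly_upper_bound P : exists2 C : F, 0 <= C & forall x, 1 <= x ->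
  `|P.[x]| <= C * x ^+ (size P).-1.
Proof.
have [C C0 CP] := poly_coef_bound (leqSpred (size P)).
set d := (size P).-1 in CP *.
exists (`|P`_d| + C) => [|x x1]; first exact: addr_ge0.
have x0 : 0 <= x by exact: le_trans x1.
rewrite -[P.[x]](subrK (P`_d * x ^+ d)) addrC.
apply: le_trans (ler_normD _ _) _; rewrite mulrDl normrM normrX (ger0_norm x0).
rewrite lerD2l; apply: le_trans (CP x x1).
by rewrite ler_peMl.
Qed.

Lemma nat_unbounded (K : F) N : exists2 n, (N <= n)%N & K < n%:R.
Proof.
exists (maxn N (Num.truncn `|K|).+1); first exact: leq_maxl.
apply: le_lt_trans (ler_norm K) _; apply: lt_le_trans (truncnS_gt _) _.
by rewrite ler_nat leq_maxr.
Qed.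

Lemma poly_growth_lt P (b c D N r : nat) : (0 < c)%N ->
  (forall n, (N <= n)%N -> (n ^ r)%:R <= b%:R * P.[(c * n + D)%:R]) ->
  (r < size P)%N.
Proof.
move=> c0 bnd; have [C C0 CP] := poly_upper_bound P.
have [P0|P0] := eqVneq P 0.
  have := bnd N.+1 (leqnSn N); rewrite P0 horner0 mulr0 lern0 expn_eq0 /=.
  by [].
rewrite ltnNge; apply/negP => sr; set d := (size P).-1 in CP.
have dr : (d < r)%N by rewrite /d prednK // size_poly_gt0.
(* For [n >= 1] one has [c n + D <= (c + D) n], so the right-hand side of the hypothesis is at most
   [K n^d], against [n^(d+1)] on the left. *)
pose K : F := b%:R * C * (c + D)%:R ^+ d.
have [n] := nat_unbounded K (maxn N 1); rewrite geq_max => /andP[Nn n1] Kn.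
have n0 : 0 < n%:R :> F by rewrite ltr0n.
suff : n%:R ^+ d.+1 <= K * n%:R ^+ d :> F.
  by rewrite exprS ler_pM2r ?exprn_gt0 // leNgt Kn.
apply: (@le_trans _ _ (n ^ r)%:R).
  by rewrite natrX ler_weXn2l // ler1n.
apply: le_trans (bnd n Nn) _; rewrite /K -!mulrA ler_wpM2l //.
apply: le_trans (ler_norm _) _; apply: le_trans (CP _ _) _.
  by rewrite ler1n; nia.
rewrite ler_wpM2l // -exprMn lerXn2r ?nnegrE ?mulr_ge0 //.
by rewrite -natrM ler_nat; nia.
Qed.

Lemma poly_not_small P (N0 : nat) : P != 0 ->
  (forall n, (N0 <= n)%N -> 0 <= P.[n%:R]) ->
  ~ forall k : nat, exists N, forall n, (N <= n)%N ->
      k%:R * P.[n%:R] <= n%:R ^+ (size P).-1.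
Proof.
move=> P0 Pge0 sm; have [C C0 CP] := poly_coef_bound (leqSpred (size P)).
set d := (size P).-1 in CP sm; rewrite -lead_coefE in CP; set a := lead_coef P in CP.
have a0 : 0 < `|a| by rewrite normr_gt0 lead_coef_eq0.
(* With [k |a| > 2], smallness would give [2 n < n + k C], which fails once [n > k C]. *)
have [k _ ka] := nat_unbounded (2 / `|a|) 0; rewrite ltr_pdivrMr // in ka.
have [N NP] := sm k; have [n] := nat_unbounded (k%:R * C) (maxn (maxn N N0) 1).
rewrite !geq_max => /andP[/andP[Nn N0n] n1] Kn.
have n0 : 0 < n%:R :> F by rewrite ltr0n.
have nd : 0 < n%:R ^+ d :> F by rewrite exprn_gt0.
have b1 : `|a| * n%:R ^+ d <= P.[n%:R] + `|P.[n%:R] - a * n%:R ^+ d|.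
  have := ler_normB P.[n%:R] (P.[n%:R] - a * n%:R ^+ d).
  by rewrite subKr normrM (ger0_norm (ltW nd)) (ger0_norm (Pge0 n N0n)).
have b2 := NP n Nn; have b3 := CP n%:R; rewrite ler1n in b3; have {}b3 := b3 n1.
have : k%:R * n%:R * (`|a| * n%:R ^+ d) <=
    n%:R * n%:R ^+ d + k%:R * C * n%:R ^+ d :> F.
  apply: le_trans (ler_wpM2l _ b1) _; first by rewrite mulr_ge0 ?ler0n.
  rewrite mulrDr lerD //.
    by rewrite mulrAC mulrC ler_wpM2l ?ler0n.
  by rewrite -!mulrA ler_wpM2l.
rewrite mulrA -mulrDl ler_pM2r // => b4.
have : 2 * n%:R < k%:R * n%:R * `|a| :> F by rewrite mulrAC ltr_pM2r.
rewrite ltNge => /negP; apply; apply: le_trans b4 _.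
by rewrite [leRHS]mulr_natl mulr2n lerD2l ltW.
Qed.

End PolynomialGrowth.

Record standard_module (S : naRingType) (gS : grading S) (N : naSpaceType S)
    (gN : grading N) := StandardModule {
  mod_assoc : forall (a b : S) (x : N), (a ** b) **: x = a **: (b **: x);
  mod_act : forall i j a x,
    hcomp gS i a -> hcomp gN j x -> hcomp gN (i + j) (a **: x);
  mod_rank : nat;
  mod_gen : nat -> N;
  mod_deg : nat -> nat;
  mod_bound : nat;
  mod_degP : forall l, hcomp gN (mod_deg l) (mod_gen l);
  mod_boundP : forall l, (mod_deg l < mod_bound)%N;
  mod_span : forall x : N, exists c : nat -> S,
    x = \sum_(l < mod_rank) c l **: mod_gen l }.

(** Generators are replaced by their homogeneous components. *)
Lemma standard_moduleP (S : naRingType) (gS : grading S) (N : naSpaceType S)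
    (gN : grading N) : finitely_generated_module N ->
  (forall i j a x, hcomp gS i a -> hcomp gN j x -> hcomp gN (i + j) (a **: x)) ->
  inhabited (standard_module gS gN).
Proof.
move=> [assoc [n [e eP]]] actM.
have [c [c0 ec]] : exists c, (0 < c)%N /\ forall i, below gN c (e i).
  have [h hP] := choice (fun i => ex_below gN (e i)).
  exists (\max_i h i).+1; split=> // i; apply: leq_below (hP i).
  by apply: leqW; exact: leq_bigmax.
pose e' l := if insub l is Some i then e i else 0.
have e'E (i : 'I_n) : e' i = e i by rewrite /e' valK.
(* Generator number [i * c + d] is the component of degree [d] of [e i], with [d < c]; the degree is
   read off as the remainder. *)
pose f m := gN (m %% c)%N (e' (m %/ c)%N).
constructor; apply: (@StandardModule _ _ _ _ assoc actM (n * c) f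
  (fun m => m %% c)%N c) => [l|l|]; [exact: comp_pr|exact: ltn_pmod|].
pose G : set N := [set x | exists b : nat -> S, x = \sum_(m < n * c) b m **: f m].
have sG : subgrp G.
  split=> [|_ _ [b ->] [b' ->]].
    by exists (fun=> 0); rewrite big1 // => i _; rewrite (biadd0l (@naactDl _ _)).
  exists (fun m => b m - b' m); rewrite -sumrB; apply: eq_bigr => i _.
  by rewrite (opBl (@naactDl _ _)).
have aG a x : G x -> G (a **: x).
  move=> [b ->]; exists (fun m => a ** b m).
  rewrite (big_morph (naact a) (@naactDr _ _ a) (biadd0r (@naactDr _ _) a)).
  by apply: eq_bigr => i _; rewrite assoc.
have fG m : (m < n * c)%N -> G (f m).
  move=> mn; exists (fun l => if l == m then naone else 0).
  rewrite (bigD1 (Ordinal mn)) //= eqxx naact1 big1 ?addr0 // => l lm.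
  case: eqP => [e0|_]; last exact: (biadd0l (@naactDl _ _)).
  by case/eqP: lm; exact: val_inj.
move=> x; have [b ->] := eP x; apply: (subgrp_sum _ sG) => i _; apply: aG.
rewrite -(truncE (ec i)); apply: (subgrp_sum _ sG) => d _.
have := fG (i * c + d)%N; rewrite /f divnMDl // modnMDl.
rewrite divn_small // modn_small // addn0 e'E; apply.
by have := ltn_ord i; have := ltn_ord d; nia.
Qed.

(** * The dimension of a finitely generated graded module *)

Section Module.
Variables (p : nat) (S : naRingType) (gS : grading S).
Hypothesis std : standard_graded p gS.
Variables (N : naSpaceType S) (gN : grading N).
Hypothesis md : standard_module gS gN.

Let actDl := @naactDl S N.
Let actDr := @naactDr S N.
Let assoc := mod_assoc md.
Let actM := mod_act md.
Let e := mod_gen md.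
Let s := mod_rank md.
Let actB (a : S) (x y : N) : a **: (x - y) = a **: x - a **: y := opBr actDr a x y.
Let act0 (a : S) : a **: (0 : N) = 0 := biadd0r actDr a.
Let sS := @subgrp_below _ gS.
Let sN := @subgrp_below _ gN.
Let s0 := @subgrp0 N.

Definition ann : set S := @annihilator S N.

Lemma ideal_ann : ideal ann.
Proof.
split; first split=> [x|a b Aa Ab x]; first exact: (biadd0l actDl).
  by rewrite (opBl actDl) Aa Ab subrr.
by move=> a b Ab x; rewrite assoc Ab act0.
Qed.

Lemma homog_ann : homog gS ann.
Proof.
move=> i a Aa; apply: (subgrp_homog_ind (g := gN)) => [|j x xj].
  by split=> [|x y /= ax ay]; rewrite /= ?act0 // actB ax ay subrr.
have := pr_opr actDl actM (i + j) a xj.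
by rewrite Aa pr0 leq_addl addnK => <-.
Qed.

Lemma pr_gen l k a : gN k (a **: e l) =
  if (mod_deg md l <= k)%N then gS (k - mod_deg md l)%N a **: e l else 0.
Proof. exact: (pr_opr actDl actM k a (mod_degP md l)). Qed.

Definition gspan j n : set N :=
  [set y | exists c : nat -> S, (forall l, below gS n (c l)) /\
     y = \sum_(l < j) c l **: e l].

Lemma subgrp_gspan j n : subgrp (gspan j n).
Proof.
split=> [|_ _ [b [bn ->]] [c [cn ->]]].
  exists (fun=> 0); split=> [l|]; first exact: (sS n).1.
  by rewrite big1 // => i _; exact: (biadd0l actDl).
exists (fun l => b l - c l); split=> [l|]; first exact: (sS n).2.
by rewrite -sumrB; apply: eq_bigr => i _; rewrite (opBl actDl).
Qed.

(** Each further generator [e j] adds a quotient of [S / Ann] truncated to degrees [< n], through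
    [a] mapped to [a **: e j]. *)
Lemma gspan_len j n : fin_index (gspan j n) [set 0] /\
  (len p (gspan j n) [set 0%R] <= j * hilb p gS ann n)%N.
Proof.
elim: j => [|j [IHf IHl]].
  have sub : gspan 0 n `<=` [set 0] by move=> _ [c [_ ->]]; rewrite big_ord0.
  split; last by rewrite len1 //; exact: subgrp_gspan.
  by apply/fin_index0; apply: sub_finite_set sub _; exact: finite_set1.
have s0g : [set 0] `<=` gspan j n by move=> _ ->; exact: (subgrp_gspan j n).1.
have sub : gspan j n `<=` gspan j.+1 n.
  move=> _ [c [cn ->]]; exists (fun l => if (l < j)%N then c l else 0).
  split=> [l|]; first by case: ifP => // _; exact: (sS n).1.
  rewrite big_ord_recr /= ltnn (biadd0l actDl) addr0.
  by apply: eq_bigr => i _; rewrite ltn_ord.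
have fB a b : below gS n a -> below gS n b ->
    (a - b) **: e j = a **: e j - b **: e j by move=> _ _; exact: (opBl actDl).
have ker a : below gS n a -> ann a -> gspan j n (a **: e j).
  by move=> _ ->; exact: (subgrp_gspan j n).1.
have fA a : below gS n a -> gspan j.+1 n (a **: e j).
  move=> an; exists (fun l => if l == j then a else 0).
  split=> [l|]; first by case: ifP => // _; exact: (sS n).1.
  rewrite big_ord_recr /= eqxx big1 ?add0r // => i _.
  by rewrite ltn_eqF //; exact: (biadd0l actDl).
have surj y : gspan j.+1 n y ->
    exists2 a, below gS n a & gspan j n (y - a **: e j).
  move=> [c [cn ->]]; exists (c j) => //; exists c; split=> //.
  by rewrite big_ord_recr /= addrK.
have sA := subgrp_gspan j.+1 n; have sB := subgrp_gspan j n.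
have finA := fin_below_sub std n ideal_ann.1.
have [fin1 _] := index_surj (sS n) ideal_ann.1 sB fB fA ker surj finA.
have len_le := len_surj p (sS n) ideal_ann.1 sB fB fA ker surj finA.
have finI : fin_index (gspan j.+1 n `&` gspan j n) [set 0] by rewrite setIidr.
have [fin2 _] := index_mul sA sB s0 s0g fin1 finI; split=> //.
rewrite (len_mul p sA sB s0 s0g fin2) setIidr // mulSn.
exact: leq_add.
Qed.

Lemma below_gspan n : below gN n `<=` gspan s n.
Proof.
move=> x xn; have [c xc] := mod_span md x.
exists (fun l => trunc gS (n - mod_deg md l) (c l)); split=> [l|].
  by apply: (leq_below (leq_subr (mod_deg md l) n)); exact: below_trunc.
apply: (pr_eq (g := gN)) => k; have [kn|nk] := ltnP k n.
  rewrite {1}xc !pr_big; apply: eq_bigr => l _; rewrite !pr_gen.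
  by case: leqP => // lk; rewrite pr_trunc ltn_sub2r //; exact: leq_ltn_trans kn.
rewrite xn // pr_big big1 // => l _; rewrite pr_gen; case: leqP => // lk.
by rewrite pr_trunc ltnNge leq_sub2r //; exact: (biadd0l actDl).
Qed.

Lemma finite_mod_comp i : finite_set (hcomp gN i).
Proof.
apply/fin_index0; apply: fin_indexS (gspan_len s i.+1).1 => x xi.
by apply: below_gspan; exact: comp_below xi.
Qed.

Lemma len_below_upper n :
  (len p (below gN n) [set 0%R] <= s * hilb p gS ann n)%N.
Proof.
have [fin] := gspan_len s n; apply: leq_trans.
apply: (@len_inj _ _ _ id) => //; first exact: subgrp_gspan.
exact: below_gspan.
Qed.

(** [a] mapped to the tuple of all [a **: e l] embeds [S / Ann] into [N^s], raising degrees by less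
    than [mod_bound]. The proof descends through the annihilators [I j] of the first [j] generators;
    [I s] annihilates [N] since [S] is commutative. *)
Lemma len_below_lower (P : set S) n : subgrp P -> ann `<=` P ->
  (hilb p gS P n <= s * len p (below gN (mod_bound md + n)) [set 0%R])%N.
Proof.
move=> sP AP; pose I j : set S := [set a | forall l, (l < j)%N -> a **: e l = 0].
have sI j : subgrp (I j).
  split=> [l _|a b Ia Ib l lj]; first exact: (biadd0l actDl).
  by rewrite (opBl actDl) Ia // Ib // subrr.
have IP : I s `<=` P.
  move=> a Ia; apply: AP => x; have [c ->] := mod_span md x.
  rewrite (big_morph (naact a) (@naactDr _ _ a) (act0 a)) big1 // => i _.
  by rewrite -assoc (std_comm std).1 assoc Ia ?act0.
apply: leq_trans (leq_hilb std sP (sI s) (leqnn n) IP) _.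
elim: s => [|j IH].
  by rewrite /hilb len1.
have II : I j.+1 `<=` I j by move=> a Ia l lj; exact: Ia (leqW lj).
rewrite /hilb (len_mul p (sS n) (sI j) (sI j.+1) II); last first.
  exact: (fin_below_sub std).
rewrite addnC mulSn; apply: leq_add IH.
apply: (@len_inj _ _ _ (fun a => a **: e j)) => //.
- exact: subgrpI.
- by move=> a b _ _; exact: (opBl actDl).
- move=> a [an _]; apply: (below_op actDl actDr actM an).
  exact: comp_below (mod_boundP md j) (mod_degP md j).
- move=> a [_ Ia]; split=> [/= ae l|/(_ j (ltnSn j)) //].
  by rewrite ltnS leq_eqVlt => /predU1P[->|/Ia].
- exact: (fin_below finite_mod_comp).
Qed.

Let f j (x : N) := std_gen std j **: x.

(** In degrees above those of all generators, every coefficient has positive degree, hence is a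
    combination of the degree-one generators of [S]. *)
Lemma module_ev_generated :
  subquotient f (hcomp gN) (fun=> [set 0]) /\
  ev_generated f (std_rank std) (hcomp gN) (fun=> [set 0]).
Proof.
have fB j x y : f j (x - y) = f j x - f j y by exact: actB.
split.
  split=> //.
  - by move=> i; exact: subgrp_comp.
  - by move=> i _ ->; exact: (subgrp_comp gN i).1.
  - by move=> i; apply/fin_index0; exact: finite_mod_comp.
  - by move=> j i a ai; have := actM (std_gen1 std j) ai.
  - by move=> j i _ ->; exact: act0.
  - by move=> j k i a _; rewrite /f /= -!assoc (std_comm std).1 subrr.
exists (mod_bound md) => i bi x xi; exists x; last by rewrite /= subrr.
have [c xc] := mod_span md x.
have sO := subgrp_opsum fB (std_rank std) (subgrp_comp gN i).
rewrite -xi {1}xc pr_big; apply: subgrp_sum => // l _; rewrite pr_gen.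
case: leqP => // li; last exact: sO.1.
have lb := mod_boundP md l.
have := comp_pr gS (i.+1 - mod_deg md l) (c l); rewrite subSn; last by lia.
move=> /(std_span std); set a := gS _ _; move: a.
move=> a; apply: (opsum_map (h := fun a => a **: e l)) => [x' y|j b|b bi'].
- exact: (opBl actDl).
- exact: assoc.
by have := actM bi' (mod_degP md l); rewrite subnK //; lia.
Qed.

Theorem module_dimension : exists (P : {poly rat}) (n0 : nat),
  (forall n, (n0 <= n)%N -> P.[n%:R] = (len p (below gN n) [set 0])%:R) /\
  is_krull_dim N ((size P)%:Z - 1).
Proof.
have fB j x y : f j (x - y) = f j x - f j y by exact: actB.
have [sq gen] := module_ev_generated.
have [P [n0 Psum]] := hilbert_serre p fB sq gen.
have PE n : (n0 <= n)%N -> P.[n%:R] = (len p (below gN n) [set 0])%:R.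
  by move=> nn; rewrite Psum // (len_below finite_mod_comp).
exists P, n0; split=> //; split; first by rewrite lerBrDr addNr.
move=> r; rewrite lerBrDr -[1]/(1%:Z) -PoszD lez_nat addn1; split.
  move=> [q [qP qS]].
  have primeQ i : (i <= r)%N -> prime_set [set x | x \in q i].
    move=> ir; have [[ql qr q1 qm] _] := qP i ir; split=> //.
    - by split; [exact: subgrp_zmodClosed|move=> a x; exact: ql].
    - exact/negP.
  have [c c0 cP] := prime_chain_hilb std primeQ qS.
  apply: (@poly_growth_lt _ P (c * s) c (mod_bound md) n0.+1 r) => // n n0n.
  have cn : (n <= c * n)%N by nia.
  rewrite PE; last by lia.
  rewrite -natrM ler_nat; apply: leq_trans (cP n _) _; first by lia.
  rewrite -mulnA leq_mul2l addnC len_below_lower ?orbT //.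
    exact: subgrp_zmodClosed.
  by move=> a Aa; exact: (qP 0%N (leq0n r)).2.
move=> rP; have P0 : P != 0 by rewrite -size_poly_gt0; exact: leq_trans rP.
(* Lengths in [N] are at most [s] times those in [S / Ann], so smallness of the latter, used with
   [k * s], would contradict the order of growth of [P]. *)
have nsmall : ~ small (size P).-1 (hilb p gS ann).
  move=> sm; apply: (@poly_not_small _ P n0 P0) => [n nn|k].
    by rewrite PE.
  have [n1 n1P] := sm (k * s)%N; exists (maxn n0 n1) => n.
  rewrite geq_max => /andP[nn n1n]; rewrite PE // -natrM -natrX ler_nat.
  by apply: leq_trans (n1P n n1n); rewrite -mulnA leq_mul2l len_below_upper orbT.
have [Q [primeQ QS]] := prime_chain_exists std ideal_ann homog_ann nsmall.
have rd : (r <= (size P).-1)%N by rewrite -ltnS prednK // size_poly_gt0.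
have sub i : (i <= r)%N -> (i <= (size P).-1)%N by move=> /leq_trans; apply.
(* [Q i] is known to be a subgroup only along the chain; past its end an arbitrary subgroup is
   substituted. *)
pose q i : zmodClosed S := match pselect (subgrp (Q i)) with
  | left sQ => subgroup sQ.1 sQ.2
  | right _ => subgroup (@subgrpT S).1 (@subgrpT S).2 end.
have qE i x : (i <= r)%N -> x \in q i = `[< Q i x >].
  move=> /sub ir; rewrite /q; case: pselect => [sQ|[]] //.
  by have [[[]]] := primeQ i ir.
have in_q i x : (i <= r)%N -> x \in q i <-> Q i x.
  by move=> ir; rewrite qE //; split=> /asboolP.
exists q; split=> i ir.
  have [[[sQ mQ] Q1 pQ] AQ] := primeQ i (sub i ir); split; last first.
    by move=> a Aa; apply/in_q => //; exact: AQ.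
  split.
  - by move=> x y /in_q-/(_ ir) Qy; apply/in_q => //; exact: mQ.
  - move=> x y /in_q-/(_ ir) Qx; apply/in_q => //.
    by rewrite (std_comm std).1; exact: mQ.
  - by apply/negP => /in_q-/(_ ir).
  - by move=> x y /in_q-/(_ ir) /pQ[]; [left|right]; apply/in_q.
have [QQ QnQ] := QS i (leq_trans ir rd); split.
  by move=> x /in_q-/(_ (ltnW ir)) Qx; apply/in_q => //; exact: QQ.
move=> qq; apply: QnQ => x /in_q-/(_ ir) /qq.
by move=> /in_q-/(_ (ltnW ir)).
Qed.

End Module.

(** * Associated graded rings and modules *)

Section DirectSumGrading.
Variables (V : zmodType) (F : nat -> zmodClosed V).
Hypothesis FS : forall i, {subset F i.+1 <= F i}.

Lemma zvalB (x y : dsum F) i : zval (x - y) i = zval x i - zval y i.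
Proof. by []. Qed.

Lemma dsum_ext (x y : dsum F) : (forall i, zval x i = zval y i) -> x = y.
Proof. by move=> xy; apply/val_inj/funext. Qed.

Fact dproj_subproof i (x : dsum F) :
  dsum_set F (fun j => if j == i then zval x j else 0).
Proof.
have [xF _] := dsumP x; split=> [j|]; first by case: ifP => // _; exact: rpred0.
by exists i.+1 => j ij; rewrite gtn_eqF.
Qed.

Definition dproj i (x : dsum F) : dsum F :=
  ZSub (introT (subgroupP _ _ _) (dproj_subproof i x)).

Lemma dprojB i x y : dproj i (x - y) = dproj i x - dproj i y.
Proof.
by apply: dsum_ext => j; rewrite zvalB /=; case: ifP; rewrite ?subrr.
Qed.

Lemma dproj_dproj i j x : dproj i (dproj j x) = if i == j then dproj j x else 0.
Proof.
apply: dsum_ext => k /=; have [->|ki] := eqVneq k i.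
  by case: (eqVneq i j) => [->|] //=; rewrite eqxx.
by case: (eqVneq i j) => [<-|] //=; rewrite (negPf ki).
Qed.

Lemma zval_sum (I : Type) (s : seq I) (P : pred I) (x : I -> dsum F) k :
  zval (\sum_(i <- s | P i) x i) k = \sum_(i <- s | P i) zval (x i) k.
Proof. by elim/big_rec2: _ => // i y1 y2 _ <-. Qed.

Lemma dproj_sum x : exists n, x = \sum_(i < n) dproj i x.
Proof.
have [_ [n xn]] := dsumP x; exists n; apply: dsum_ext => k.
rewrite zval_sum; have [kn|nk] := ltnP k n.
  rewrite (bigD1 (Ordinal kn)) //= eqxx big1 ?addr0 // => i ik.
  by case: eqP => // e; case/eqP: ik; apply: val_inj.
rewrite xn // big1 // => i _ /=; case: eqP => // e.
by have := ltn_ord i; rewrite -e ltnNge nk.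
Qed.

Local Notation gr := {quot (dsum_shift F)}.
Local Notation pi := (\pi_gr).

Lemma pi_eq0 (x : dsum F) : pi x = 0 <-> forall i, zval x i \in F i.+1.
Proof.
have -> : (pi x = 0) = (pi x = pi 0) by rewrite raddf0.
split=> [/eqP|xF].
  by rewrite -Quotient.idealrBE subr0 => /subgroupP.
by apply/eqP; rewrite -Quotient.idealrBE subr0; apply/subgroupP.
Qed.

Lemma pi_eq (x y : dsum F) :
  pi x = pi y <-> forall i, zval x i - zval y i \in F i.+1.
Proof.
split=> [e|xy]; first by apply/(pi_eq0 (x - y)); rewrite raddfB /= e subrr.
by apply: subr0_eq; rewrite -raddfB; apply/pi_eq0.
Qed.

Definition gr_proj i (q : gr) : gr := pi (dproj i (repr q)).

Lemma gr_projE i x : gr_proj i (pi x) = pi (dproj i x).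
Proof.
rewrite /gr_proj; apply/pi_eq => j /=; case: eqP => _; last by rewrite subrr rpred0.
by have /pi_eq := @reprK _ gr (pi x); apply.
Qed.

Fact gr_projB i x y : gr_proj i (x - y) = gr_proj i x - gr_proj i y.
Proof.
by rewrite -[x]reprK -[y]reprK -raddfB !gr_projE dprojB raddfB.
Qed.

Fact gr_proj_proj i j x :
  gr_proj i (gr_proj j x) = if i == j then gr_proj j x else 0.
Proof.
have <- := reprK x; move: (repr x) => y.
rewrite (gr_projE j y) (gr_projE i (dproj j y)) dproj_dproj.
by case: eqP => // _; rewrite raddf0.
Qed.

Fact gr_proj_sum x : exists n, x = \sum_(i < n) gr_proj i x.
Proof.
have [n e] := dproj_sum (repr x); exists n.
by rewrite -{1}[x]reprK {1}e raddf_sum.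
Qed.

Definition gr_grading : grading gr := Grading gr_projB gr_proj_proj gr_proj_sum.

Fact single_subproof i (v : zsub (F i)) :
  dsum_set F (fun j => if j == i then zval v else 0).
Proof.
split=> [j|]; first by case: eqP => [->|_]; [exact: zvalP|exact: rpred0].
by exists i.+1 => j ij; rewrite gtn_eqF.
Qed.

Definition single i (v : zsub (F i)) : dsum F :=
  ZSub (introT (subgroupP _ _ _) (single_subproof v)).

(** The initial form of [v] in degree [i], zero exactly when [v] lies one step deeper in the
    filtration. *)
Definition symb i (v : zsub (F i)) : gr := pi (single v).

Lemma symbB i (u v : zsub (F i)) : symb (u - v) = symb u - symb v.
Proof.
rewrite /symb -raddfB; congr (pi _); apply: dsum_ext => j.
by rewrite zvalB /=; case: ifP; rewrite ?subrr.
Qed.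

Lemma symb_comp i (v : zsub (F i)) : hcomp gr_grading i (symb v).
Proof.
rewrite /hcomp /= gr_projE; congr (pi _); apply: dsum_ext => j /=.
by case: (j == i).
Qed.

Lemma comp_symb i x : hcomp gr_grading i x -> exists v : zsub (F i), x = symb v.
Proof.
rewrite /hcomp /= => <-; have [xF _] := dsumP (repr x).
exists (ZSub (xF i)); congr (pi _); apply: dsum_ext => j /=.
by case: eqP => // ->.
Qed.

Lemma symb_eq0 i (v : zsub (F i)) : symb v = 0 <-> zval v \in F i.+1.
Proof.
split=> [/pi_eq0/(_ i)|vF] /=; first by rewrite eqxx.
by apply/pi_eq0 => j /=; case: eqP => [->//|_]; exact: rpred0.
Qed.

End DirectSumGrading.

Lemma pi_quot0 (V : zmodType) (B : zmodClosed V) x :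
  \pi_({quot B}) x = 0 <-> x \in B.
Proof.
have -> : (\pi_({quot B}) x = 0) = (\pi_({quot B}) x = \pi_({quot B}) 0).
  by rewrite raddf0.
split=> [/eqP|xB]; first by rewrite -Quotient.idealrBE subr0.
by apply/eqP; rewrite -Quotient.idealrBE subr0.
Qed.

Lemma card_quot (V : zmodType) (B : zmodClosed V) :
  [set: {quot B}] #= cosets [set: V] [set x | x \in B].
Proof.
have -> : [set: {quot B}] = [set \pi_({quot B}) x | x in [set: V]].
  by apply/seteqP; split=> // q _; exists (repr q) => //; exact: reprK.
apply: card_image_eq => x y _ _; rewrite coset_eq; last exact: subgrp_zmodClosed.
split=> [/eqP|/= xy]; first by rewrite eq_sym -Quotient.idealrBE.
by apply/eqP; rewrite eq_sym -Quotient.idealrBE.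
Qed.

Lemma quot_finite (V : zmodType) (B : zmodClosed V) :
  finite_set [set: {quot B}] <-> fin_index [set: V] [set x | x \in B].
Proof. by rewrite /fin_index (eq_finite_set (card_quot B)). Qed.

Lemma quot_index (V : zmodType) (B : zmodClosed V) :
  finite_set [set: {quot B}] ->
  card_type {quot B} = sgindex [set: V] [set x | x \in B].
Proof.
move=> fin; have e := card_quot B; have /finite_setP[n An] := fin.
rewrite /card_type /sgindex !(@card_fset_set _ _ n) //.
by rewrite -(card_eql e).
Qed.

Lemma conv_single (U V W : zmodType) (b : U -> V -> W)
    (bDl : forall x y z, b (x + y) z = b x z + b y z)
    (bDr : forall x y z, b x (y + z) = b x y + b x z) i j u v n :
  Defs.conv b (fun k => if k == i then u else 0)
    (fun k => if k == j then v else 0) n =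
  if n == (i + j)%N then b u v else 0.
Proof.
rewrite /Defs.conv; case: eqP => [->|nij].
  have ij : (i < (i + j).+1)%N by rewrite ltnS leq_addr.
  rewrite (bigD1 (Ordinal ij)) //= eqxx addKn eqxx big1 ?addr0 // => k ki.
  by case: eqP => [e|_]; [case/eqP: ki; exact: val_inj|exact: (biadd0l bDl)].
apply: big1 => k _; case: eqP => [e|_]; last exact: (biadd0l bDl).
case: eqP => [e'|_]; last exact: (biadd0r bDr).
by case: nij; have := ltn_ord k; lia.
Qed.

Section GrRing.
Variables (R : naRingType) (m : ring_filtration R).

Definition gr_ring_grading : grading (gr_ring m) := gr_grading m.
Definition rsymb i (u : zsub (m i)) : gr_ring m := symb u.

Lemma rsymbM i j (u : zsub (m i)) (v : zsub (m j)) :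
  rsymb u ** rsymb v = rsymb (ZSub (rfiltM (zvalP u) (zvalP v))).
Proof.
rewrite /rsymb /symb [LHS](quot_mulE (rees_ideal m)); congr (\pi_(_) _).
apply/val_inj/funext => n /=.
exact: (conv_single (@namulDl R) (@namulDr R)).
Qed.

Lemma rsymb1 : (naone : gr_ring m) = rsymb (ZSub (rfilt0 m naone)).
Proof. by congr (\pi_(_) _); apply/val_inj/funext => n. Qed.

Lemma gr_comp_mul i j a b : hcomp gr_ring_grading i a -> hcomp gr_ring_grading j b ->
  hcomp gr_ring_grading (i + j) (a ** b).
Proof.
move=> /comp_symb[u ->] /comp_symb[v ->].
rewrite -[symb u]/(rsymb u) -[symb v]/(rsymb v) rsymbM; exact: symb_comp.
Qed.

Lemma gr_component_comp i : gr_component m i `<=` hcomp gr_ring_grading i.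
Proof.
move=> _ [x hx <-]; rewrite /hcomp /= gr_projE; congr (\pi_(_) _).
by apply: dsum_ext => j /=; case: eqP => // ji; rewrite hx.
Qed.

Definition rsymb0 (x : R) : gr_ring m := rsymb (ZSub (rfilt0 m x)).

Lemma rsymb0B x y : rsymb0 (x - y) = rsymb0 x - rsymb0 y.
Proof. by rewrite /rsymb0 -[RHS]symbB; congr (rsymb _); exact: val_inj. Qed.

Lemma comp0_rsymb0 a : hcomp gr_ring_grading 0 a -> exists x, a = rsymb0 x.
Proof.
move=> /comp_symb[u ->]; exists (zval u); congr (rsymb _); exact: val_inj.
Qed.

Lemma cosets_residue : cosets [set: R] [set x | x \in m 1%N] #=
  cosets (hcomp gr_ring_grading 0) [set 0].
Proof.
apply: (@index_bij _ _ rsymb0) => //.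
- exact: subgrp_zmodClosed.
- exact: subgrp0.
- by move=> x y _ _; exact: rsymb0B.
- by move=> x _; exact: symb_comp.
- by move=> x _; exact: symb_eq0.
by move=> a /comp0_rsymb0[x ->]; exists x => //=; rewrite subrr.
Qed.

Hypothesis local : complete_local_filtered m.
Hypothesis finite_residue : finite_set [set: residue_ring m].

Let q := card_type (residue_ring m).

Lemma index_comp0 : fin_index (hcomp gr_ring_grading 0) [set 0] /\
  sgindex (hcomp gr_ring_grading 0) [set 0%R] = q.
Proof.
have e := cosets_residue; rewrite card_eq_sym in e.
rewrite /q [card_type _](quot_index finite_residue); apply: index_eq e.
exact/(quot_finite (max_ideal m)).
Qed.

Lemma gr_comp0_field a : hcomp gr_ring_grading 0 a -> a <> 0 ->
  exists b, a ** b = naone.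
Proof.
have [_ [_ _ inv] _ _ _] := local.
move=> /comp0_rsymb0[x ->] x0.
have [y xy] : exists y : residue_ring m,
      (\pi_({quot max_ideal m}) x : residue_ring m) ** y = naone.
  apply: inv => x1; apply: x0; apply/symb_eq0.
  exact/(pi_quot0 (max_ideal m)).
exists (rsymb0 (repr y)); rewrite rsymbM rsymb1 /=.
apply: subr0_eq; rewrite -[LHS]symbB; apply/symb_eq0 => /=.
move: xy; rewrite -{1}[y]reprK [LHS](quot_mulE (max_ideal m)) => /eqP.
by rewrite -Quotient.idealrBE.
Qed.

End GrRing.

Lemma algebra_generated_ind (S : naRingType) (A X T : set S) :
  algebra_generated A X -> subgrp T ->
  (forall x y, T x -> T y -> T (x ** y)) -> A `<=` T -> X `<=` T ->
  forall x, T x.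
Proof.
move=> gen sT TM AT XT x; apply/(subgroupP sT.1 sT.2); apply: gen.
- by move=> y z /subgroupP Ty /subgroupP Tz; apply/subgroupP; exact: TM.
- by move=> y Ay; apply/subgroupP; exact: AT.
- by move=> y Xy; apply/subgroupP; exact: XT.
Qed.

(** The degree-one components [x j] of the finite generating set suffice. From
    [(a b)_1 = a_0 b_1 + a_1 b_0] they span degree 1 over degree 0; generation in degree 1 then
    spreads this to all degrees, each term of [(a b)_(i+1)] having a factor of positive degree. *)
Lemma generated_standard p (S : naRingType) (g : grading S) (X : seq S) :
  na_commutative_ring S ->
  (forall i j a b, hcomp g i a -> hcomp g j b -> hcomp g (i + j) (a ** b)) ->
  hcomp g 0 naone -> finite_set (hcomp g 0) ->
  (forall a, hcomp g 0 a -> a <> 0 -> exists b, a ** b = naone) ->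
  prime p -> (p %| sgindex (hcomp g 0) [set 0%R])%N ->
  algebra_generated (hcomp g 0) [set` X] ->
  algebra_generated (hcomp g 0) (hcomp g 1) ->
  inhabited (standard_graded p g).
Proof.
move=> comm mulM one0 fin0 field0 pp pdvd genX gen1.
have [mulC mulA] := comm.
have mulDl := @namulDl S; have mulDr := @namulDr S.
have prM := pr_op mulDl mulDr mulM.
pose x j := g 1%N (nth 0 X j); pose f j (a : S) := x j ** a.
have x1 j : hcomp g 1 (x j) by exact: comp_pr.
have fB j a b : f j (a - b) = f j a - f j b by exact: (opBr mulDr).
pose T i := opsum f (size X) (hcomp g i).
have sT i : subgrp (T i) by exact: (subgrp_opsum fB _ (subgrp_comp g i)).
have TM i j a b : T i a -> hcomp g j b -> T (i + j)%N (a ** b).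
  move=> Ta bj; apply: (opsum_map (h := fun y => y ** b)) Ta => [y z|k y|y yi].
  - exact: (opBl mulDl).
  - by rewrite /f mulA.
  - exact: mulM.
have T1 a : T 0%N (g 1%N a).
  move: a; apply: (algebra_generated_ind genX) => [|a b /= Ta Tb|a a0|a aX].
  - split=> [|a b /= Ta Tb]; first by rewrite /= pr0; exact: (sT _).1.
    by rewrite prB; exact: (sT _).2.
  - rewrite prM !big_ord_recl big_ord0 /= addr0; apply: (subgrpD (sT _)).
      by rewrite mulC; exact: (TM 0%N 0%N _ _ Tb (comp_pr g 0 a)).
    exact: (TM 0%N 0%N _ _ Ta (comp_pr g 0 b)).
  - by rewrite /= (pr_comp 1 a0); exact: (sT _).1.
  rewrite /= -(nth_index 0 aX) -/(x _) -[x _]namul1r.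
  by apply: (opsum_in fB (subgrp_comp g 0)); first rewrite index_mem.
have TS a i : T i (g i.+1 a).
  move: a i; apply: (algebra_generated_ind gen1) => [|a b /= Ta Tb i|a a0 i|a a1 i].
  - split=> [i|a b /= Ta Tb i]; first by rewrite pr0; exact: (sT _).1.
    by rewrite prB; exact: (sT _).2.
  - rewrite prM; apply: (subgrp_sum _ (sT i)) => -[[|l] lt_li] _ /=.
      by rewrite mulC -[i in T i]addn0; exact: TM (Tb i) (comp_pr g 0 a).
    have := TM l (i - l)%N _ _ (Ta l) (comp_pr g (i - l) b).
    by rewrite subnKC // subSS.
  - by rewrite /= (pr_comp _ a0); exact: (sT _).1.
  rewrite /= (pr_comp _ a1); case: i => [|i] /=; last exact: (sT _).1.
  by rewrite -a1; exact: T1.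
constructor; apply: (@StandardGraded p S g comm mulM one0 fin0 field0
  pp pdvd (size X) x x1) => i a ai.
by rewrite -ai; exact: TS.
Qed.

Section GrStandard.
Variables (R : naRingType) (m : ring_filtration R).
Hypothesis local : complete_local_filtered m.
Hypothesis finite_residue : finite_set [set: residue_ring m].
Local Notation S := (gr_ring m).
Local Notation g := (gr_ring_grading m).

Lemma gr_standard p : prime p -> (p %| card_type (residue_ring m))%N ->
  inhabited (standard_graded p g).
Proof.
move=> pp pq; have [_ _ comm [X genX] gen1] := local.
have [fin0 q0] := index_comp0 finite_residue.
have c0 := @gr_component_comp _ m 0; have c1 := @gr_component_comp _ m 1.
apply: (@generated_standard p S g X) => //.
- exact: gr_comp_mul.
- by rewrite rsymb1; exact: symb_comp.
- exact/fin_index0.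
- exact: gr_comp0_field.
- by rewrite q0.
- by move=> B MB B0 BX; apply: genX => // x /c0; exact: B0.
- move=> B MB B0 B1; apply: gen1 => // x.
    by move=> /c0; exact: B0.
  by move=> /c1; exact: B1.
Qed.

Variables (M : naSpaceType R) (G : space_filtration m M).

Definition gr_space_grading : grading (gr_space G) := gr_grading G.
Definition ssymb i (u : zsub (G i)) : gr_space G := symb u.

Lemma ssymb_act i j (u : zsub (m i)) (v : zsub (G j)) :
  rsymb u **: ssymb v = ssymb (ZSub (sfiltM (zvalP u) (zvalP v))).
Proof.
rewrite /ssymb /symb [LHS](quot_actE (rees_subspace G)); congr (\pi_(_) _).
apply/val_inj/funext => n /=.
exact: (conv_single (@naactDl R M) (@naactDr R M)).
Qed.

Lemma gr_comp_act i j a x : hcomp g i a -> hcomp gr_space_grading j x ->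
  hcomp gr_space_grading (i + j) (a **: x).
Proof.
move=> /comp_symb[u ->] /comp_symb[v ->].
by rewrite -[symb u]/(rsymb u) -[symb v]/(ssymb v) ssymb_act; exact: symb_comp.
Qed.

Lemma cosets_layer i :
  cosets [set: filt_space G i] [set x | x \in layer_group G i] #=
  cosets (hcomp gr_space_grading i) [set 0].
Proof.
apply: (@index_bij _ _ (@ssymb i)) => //.
- exact: subgrp_zmodClosed.
- exact: subgrp0.
- by move=> x y _ _; exact: symbB.
- by move=> x _; exact: symb_comp.
- move=> x _; split=> [/symb_eq0 x0|/subgroupP x0]; last exact/symb_eq0.
  exact/subgroupP.
by move=> a /comp_symb[x ->]; exists x => //=; rewrite subrr.
Qed.

Lemma cosets_filt i :
  cosets [set: filt_space G i] [set x | x \in layer_group G i] #=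
  cosets [set x | x \in G i] [set x | x \in G i.+1].
Proof.
apply: (@index_bij _ _ (@zval M (G i))) => //.
- exact: subgrp_zmodClosed.
- exact: subgrp_zmodClosed.
- by move=> x _; exact: zvalP.
- by move=> x _; split=> [x0|/subgroupP //]; exact/subgroupP.
by move=> x xG; exists (ZSub xG) => //=; rewrite subrr rpred0.
Qed.

(** [R] need not act associatively on [M]; the law is read off in [gr M] on symbols of degrees 0, 0
    and [i]. *)
Lemma layer_assoc i :
  (forall (a b : S) (x : gr_space G), (a ** b) **: x = a **: (b **: x)) ->
  forall (a b : residue_ring m) (x : layer G i),
    (a ** b) **: x = a **: (b **: x).
Proof.
move=> assoc a b x; rewrite -[a]reprK -[b]reprK -[x]reprK.
move: (repr a) (repr b) (repr x) => {}a {}b {}x.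
have := assoc (rsymb0 m a) (rsymb0 m b) (ssymb x).
rewrite rsymbM !ssymb_act => /eqP; rewrite -subr_eq0 -[X in X == 0]symbB.
move=> /eqP/symb_eq0 /= abx.
pose L := @QuotSubspace R (max_ideal m) (filt_space G i) (layer_group G i)
  (@layer_subspaceM R m M G i) (@layer_subspaceI R m M G i).
have actE (c : R) (y : filt_space G i) :
  (\pi_({quot max_ideal m}) c : residue_ring m) **:
    (\pi_({quot layer_group G i}) y : layer G i) =
  \pi_({quot layer_group G i}) (filt_act c y) := quot_actE L c y.
rewrite [X in X **: _](quot_mulE (max_ideal m)).
apply: etrans (actE _ _) _; apply: esym.
apply: etrans (congr1 _ (actE b x)) _; apply: etrans (actE a _) _; apply: esym.
by apply: subr0_eq; rewrite -raddfB; apply/pi_quot0/subgroupP.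
Qed.

End GrStandard.

(** * Bases and Hilbert-Samuel functions *)

Section FiniteBasis.
Variables (K : naRingType) (V : naSpaceType K).
Hypothesis fieldK : na_field K.
Hypothesis finK : finite_set [set: K].
Hypothesis finV : finite_set [set: V].
Hypothesis assoc : forall (a b : K) (x : V), (a ** b) **: x = a **: (b **: x).

Definition comb d (e : 'I_d -> V) (c : 'I_d -> K) := \sum_(i < d) c i **: e i.

Lemma finite_enum (T : choiceType) : finite_set [set: T] ->
  exists (T' : finType) (f : T' -> T) (h : T -> T'),
    [/\ cancel f h, cancel h f & #|T'| = card_type T].
Proof.
move=> fin; have inT x : x \in fset_set [set: T] by rewrite in_fset_set // inE.
exists (fset_set [set: T]), val, (fun x => [` inT x]%fset); split=> [x|x|] //.
  exact: val_inj.
by rewrite /card_type cardfE.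
Qed.

Lemma field_gt1 : (1 < card_type K)%N.
Proof.
have [_ n1 _] := fieldK; rewrite /card_type.
have /fsubset_leq_card : ([fset (naone : K); 0] `<=` fset_set [set: K])%fset.
  by apply/fsubsetP => x _; rewrite in_fset_set // inE.
by apply: leq_trans; rewrite cardfs2; case: eqP.
Qed.

Lemma comb_inj_card d (e : 'I_d -> V) : injective (comb e) ->
  (card_type K ^ d <= card_type V)%N.
Proof.
have [K' [fK [hK [fhK hfK <-]]]] := finite_enum finK.
have [V' [fV [hV [fhV hfV <-]]]] := finite_enum finV.
move=> inj; rewrite -[d in (_ ^ d)%N]card_ord -card_ffun.
apply: (@leq_card _ _ (fun c : {ffun 'I_d -> K'} => hV (comb e (fK \o c)))).
move=> c c' /(can_inj hfV)/inj cc'; apply/ffunP => i.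
by apply: (can_inj fhK); exact: (congr1 (fun h => h i) cc').
Qed.

Lemma basis_card d : has_basis V d -> card_type V = (card_type K ^ d)%N.
Proof.
move=> [e eP]; apply/eqP; rewrite eqn_leq; apply/andP; split; last first.
  apply: (@comb_inj_card _ e) => c c' cc'.
  by have [c0 [_ uniq]] := eP (comb e c); rewrite -(uniq c) // -(uniq c').
have [K' [fK [hK [fhK hfK <-]]]] := finite_enum finK.
have [V' [fV [hV [fhV hfV <-]]]] := finite_enum finV.
have [c cP] := choice (fun x => let: ex_intro c cP := eP x in
  ex_intro (fun c => x = comb e c) c cP.1).
rewrite -[d in (_ ^ d)%N]card_ord -card_ffun.
apply: (@leq_card _ _ (fun x => [ffun i => hK (c (fV x) i)] : {ffun 'I_d -> K'})).
move=> x y /ffunP xy; apply: (can_inj fhV); rewrite (cP (fV x)) (cP (fV y)).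
by apply: eq_bigr => i _; have := xy i; rewrite !ffunE => /(can_inj hfK) ->.
Qed.

(** An independent family of [d] vectors has [|K|^d <= |V|], and [|K| > 1] bounds [d]; a family of
    maximal size spans. *)
Lemma finite_has_basis : has_basis V (vdim V).
Proof.
suff [d basis] : exists d, has_basis V d.
  exact: (@xgetPex _ 0%N [set d | has_basis V d] (ex_intro _ d basis)).
have [[mulC mulA] n1 inv] := fieldK.
have actDl := @naactDl K V; have actDr := @naactDr K V.
pose P d := `[< exists e : 'I_d -> V, injective (comb e) >].
have exP : exists d, P d.
  by exists 0%N; apply/asboolP; exists (fun=> 0) => c c' _; apply/funext => -[[]].
have bP d : P d -> (d <= card_type V)%N.
  move=> /asboolP[e /comb_inj_card]; apply: leq_trans.
  by apply: ltnW; apply: ltn_expl; exact: field_gt1.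
case: (ex_maxnP exP bP) => d /asboolP[e inj] max; exists d, e => x.
suff [c cx] : exists c, x = comb e c.
  by exists c; split=> // c' cx'; apply: inj; rewrite -cx.
apply: contrapT => nx; suff /max : P d.+1 by rewrite ltnn.
pose e' i := if unlift ord0 i is Some j then e j else x.
apply/asboolP; exists e' => c c'.
have combE b : comb e' b = b ord0 **: x + comb e (fun j => b (lift ord0 j)).
  rewrite /comb big_ord_recl /e' unlift_none; congr (_ + _).
  by apply: eq_bigr => i _; rewrite liftK.
rewrite !combE; have [e0|ne0] := pselect (c ord0 = c' ord0).
  rewrite e0 => /addrI/inj cc'; apply/funext => i.
  by case: (unliftP ord0 i) => [j ->|->] //; exact: (congr1 (fun h => h j) cc').
move=> cc'; have [y ky] : exists y, (c ord0 - c' ord0) ** y = naone.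
  by apply: inv => /subr0_eq.
case: nx; exists (fun j => y ** (c' (lift ord0 j) - c (lift ord0 j))).
rewrite /comb; under eq_bigr => j _ do rewrite assoc (opBl actDl).
rewrite -(big_morph (naact y) (actDr y) (biadd0r actDr y)) sumrB.
have -> : \sum_(j < d) c' (lift ord0 j) **: e j -
    \sum_(j < d) c (lift ord0 j) **: e j = (c ord0 - c' ord0) **: x.
  rewrite (opBl actDl); apply: (addrI (c' ord0 **: x)); rewrite subrKC.
  by rewrite addrA -[X in X - _ = _]cc' addrK.
by rewrite -assoc mulC ky naact1.
Qed.

End FiniteBasis.

Lemma residue_gt1 (R : naRingType) (m : ring_filtration R) :
  complete_local_filtered m -> finite_set [set: residue_ring m] ->
  (1 < card_type (residue_ring m))%N.
Proof. by move=> [_ fieldK _ _ _]; exact: field_gt1. Qed.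

Lemma leq_filt (V : zmodType) (F : nat -> zmodClosed V) :
  (forall i, {subset F i.+1 <= F i}) ->
  forall i j, (i <= j)%N -> {subset F j <= F i}.
Proof.
move=> FS i j /subnK <-; elim: (j - i)%N => // k IH x /FS; exact: IH.
Qed.

Lemma krull_dimE (S : naRingType) (N : naSpaceType S) d :
  is_krull_dim N d -> krull_dim N = d.
Proof.
move=> kd; have : is_krull_dim N (krull_dim N).
  by apply: (@xgetPex _ (-1) [set d | is_krull_dim N d]); exists d.
have le (a b : int) : is_krull_dim N a -> is_krull_dim N b -> a <= b.
  move=> [a1 aP] [b1 bP]; rewrite leNgt; apply/negP => ba.
  have /aP/bP : (`|a|%N)%:Z <= a by lia.
  lia.
by move=> kd'; apply/eqP; rewrite eq_le !le.
Qed.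

Lemma natpoly_unique (P Q : {poly rat}) N :
  (forall n, (N <= n)%N -> P.[n%:R] = Q.[n%:R]) -> P = Q.
Proof.
move=> PQ; apply/eqP; rewrite -subr_eq0; apply: contraT => PQ0.
pose s : seq rat := [seq (N + i)%:R | i <- iota 0 (size (P - Q))].
have := @max_poly_roots _ (P - Q) s PQ0; rewrite size_map size_iota ltnn.
apply.
  apply/allP => _ /mapP[i _ ->]; rewrite rootE hornerD hornerN PQ ?leq_addr //.
  by rewrite subrr.
rewrite map_inj_uniq ?iota_uniq // => i j /eqP.
by rewrite eqr_nat eqn_add2l => /eqP.
Qed.

Section PermissibleFiltration.
Variables (R : naRingType) (m : ring_filtration R).
Hypothesis local : complete_local_filtered m.
Hypothesis finite_residue : finite_set [set: residue_ring m].
Variables (M : naSpaceType R) (G : space_filtration m M).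
Hypothesis permG : permissible G.

Let q := card_type (residue_ring m).
Let p := pdiv q.
Let q1 : (1 < q)%N := residue_gt1 local finite_residue.
Let pp : prime p := pdiv_prime q1.
Let std : inhabited (standard_graded p (gr_ring_grading m)) :=
  gr_standard local finite_residue pp (pdiv_dvd q).
Let md : inhabited (standard_module (gr_ring_grading m) (gr_space_grading G)) :=
  standard_moduleP permG.2 (@gr_comp_act _ m _ G).

Let sG i : subgrp [set x | x \in G i] := subgrp_zmodClosed (G i).
Let GS : forall i, {subset G i.+1 <= G i} := @sfiltS _ _ _ G.

Lemma fin_layer i : fin_index [set x | x \in G i] [set x | x \in G i.+1] /\
  sgindex [set x | x \in G i] [set x | x \in G i.+1] = (q ^ vdim (layer G i))%N /\
  sgindex (hcomp (gr_space_grading G) i) [set 0] = (q ^ vdim (layer G i))%N.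
Proof.
have [st] := std; have [mo] := md.
have fin0 : fin_index (hcomp (gr_space_grading G) i) [set 0].
  by apply/fin_index0; exact: (finite_mod_comp st mo).
have [fin1 e1] := index_eq fin0 (cosets_layer G i).
have fin2 : finite_set [set: layer G i] by apply/quot_finite.
have [_ fieldK _ _ _] := local.
have basis := finite_has_basis fieldK finite_residue fin2 (layer_assoc permG.2.1).
have cardE := basis_card finite_residue fin2 basis.
have e2 : cosets [set x | x \in G i] [set x | x \in G i.+1] #=
    cosets [set: filt_space G i] [set x | x \in layer_group G i].
  by rewrite card_eq_sym; exact: cosets_filt.
have [fin3 e3] := index_eq fin1 e2.
by split=> //; rewrite e3 -e1 -/q -cardE [card_type _]quot_index.
Qed.

Definition hsum n := (\sum_(k < n) vdim (layer G k))%N.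

Lemma index_filt n : fin_index [set: M] [set x | x \in G n] /\
  sgindex [set: M] [set x | x \in G n] = (q ^ hsum n)%N.
Proof.
elim: n => [|n [IHf IHe]].
  have sub : [set: M] `<=` [set x | x \in G 0%N] by move=> x _; exact: sfilt0.
  rewrite /hsum big_ord0 index1 //; split=> //.
  apply: sub_finite_set (finite_set1 (coset [set x | x \in G 0%N] 0)).
  by move=> _ [x _ <-]; apply/coset_eq => //; exact: sub.
have sub : [set x | x \in G n.+1] `<=` [set x | x \in G n] by move=> x; exact: GS.
have [fin [e _]] := fin_layer n.
have [] := index_mul (@subgrpT M) (sG n) (sG n.+1) sub IHf _; rewrite setTI //.
by move=> fin' ->; split=> //; rewrite IHe e -expnD /hsum big_ord_recr.
Qed.

Lemma hilbert_samuelP :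
  (exists N, forall n, (N <= n)%N -> (hilbert_samuel G).[n%:R] = (hsum n)%:R) /\
  (size (hilbert_samuel G))%:Z = krull_dim (gr_space G) + 1.
Proof.
have [st] := std; have [mo] := md.
have [P [N [PE kd]]] := module_dimension st mo.
have lq : (0 < logn p q)%N.
  by rewrite logn_gt0 mem_primes pp pdiv_dvd andbT /= (ltn_trans _ q1).
have lq0 : (logn p q)%:R != 0 :> rat by rewrite pnatr_eq0 -lt0n.
(* A layer of dimension [v] has order [q^v], hence length [v] times the exponent of [p] in [q]. *)
pose Q := (logn p q)%:R^-1 *: P.
have QE n : (N <= n)%N -> Q.[n%:R] = (hsum n)%:R.
  move=> Nn; rewrite /Q hornerZ PE // (len_below (finite_mod_comp st mo)).
  rewrite (eq_bigr (fun k : 'I_n => (vdim (layer G k) * logn p q)%N)); last first.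
    by move=> k _; rewrite /len (fin_layer k).2.2 lognX.
  by rewrite -big_distrl /= natrM mulrCA mulVf // mulr1.
have sumE n : (\sum_(1 <= k < n.+1) vdim (layer G k.-1))%N = hsum n.
  by rewrite big_add1 big_mkord.
have hsQ : is_hilbert_samuel G Q by exists N => n /QE ->; rewrite sumE.
have -> : hilbert_samuel G = Q.
  have : is_hilbert_samuel G (hilbert_samuel G).
    by apply: (@xgetPex _ 0 [set P | is_hilbert_samuel G P]); exists Q.
  move=> [N1 hsE]; apply: (@natpoly_unique _ _ (maxn N N1)) => n.
  by rewrite geq_max => /andP[Nn N1n]; rewrite hsE // sumE QE.
split; first by exists N.
rewrite /Q size_scale ?invr_eq0 //.
by rewrite (krull_dimE kd) subrK.
Qed.

End PermissibleFiltration.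

(** * Comparison of a permissible filtration with the powers of the maximal ideal *)

Section Approximation.
Variables (R : naRingType) (m : ring_filtration R).
Hypothesis local : complete_local_filtered m.
Variables (M : naSpaceType R) (G : space_filtration m M).
Hypothesis permG : permissible G.

Let mS : forall i, {subset m i.+1 <= m i} := @rfiltS _ m.
Let GS : forall i, {subset G i.+1 <= G i} := @sfiltS _ _ _ G.
Let actDl := @naactDl R M.
Let actDr := @naactDr R M.

(** The [x l] lift homogeneous generators of [gr M]. The symbol of [y] in degree [i] is a
    combination of them with coefficients of degree [i] minus the degree of the generator, at least
    [i - c]; lifting these leaves an error one step deeper. *)
Lemma filt_approx : exists (s c : nat) (x : nat -> M), forall i y,
  (c <= i)%N -> y \in G i -> exists a : nat -> R,
    (forall l, a l \in m (i - c)%N) /\ y - \sum_(l < s) a l **: x l \in G i.+1.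
Proof.
have [md] := standard_moduleP permG.2 (@gr_comp_act _ m _ G).
pose v l := sval (cid (comp_symb (mod_degP md l))).
have vE l : mod_gen md l = symb (v l).
  exact: (svalP (cid (comp_symb (mod_degP md l)))).
exists (mod_rank md), (mod_bound md), (fun l => zval (v l)) => i y ci yG.
have [b bE] := mod_span md (ssymb (ZSub yG)).
pose w l := sval (cid (comp_symb
  (comp_pr (gr_ring_grading m) (i - mod_deg md l)%N (b l)))).
have wE l : gr_ring_grading m (i - mod_deg md l)%N (b l) = symb (w l).
  exact: (svalP (cid (comp_symb (comp_pr (gr_ring_grading m) _ (b l))))).
exists (fun l => zval (w l)); split=> [l|].
  apply: leq_filt mS _ _ _ _ (zvalP (w l)).
  by apply: leq_sub2l; exact: ltnW (mod_boundP md l).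
pose z l : zsub (G (i - mod_deg md l + mod_deg md l)%N) :=
  ZSub (sfiltM (zvalP (w l)) (zvalP (v l))).
have dl l : (mod_deg md l <= i)%N.
  exact: leq_trans (ltnW (mod_boundP md l)) ci.
have : ssymb (ZSub yG) - \sum_(l < mod_rank md) ssymb (z l) = 0.
  apply/eqP; rewrite subr_eq0; apply/eqP.
  have <- : gr_space_grading G i (ssymb (ZSub yG)) = ssymb (ZSub yG).
    exact: symb_comp.
  rewrite {1}bE pr_big; apply: eq_bigr => l _.
  rewrite pr_gen dl [X in X **: _]wE [X in _ **: X]vE.
  exact: ssymb_act.
rewrite /ssymb /symb -raddf_sum -raddfB => /pi_eq0/(_ i).
rewrite zvalB zval_sum /= eqxx.
under eq_bigr => l _ do rewrite subnK ?dl // eqxx.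
by [].
Qed.

(** Successive approximation: the coefficients of the expansions converge since
    [R] is complete, and their limits are exact since [G] is separated. *)
Lemma filt_sub_span : exists c, forall n y,
  y \in G (n + c)%N -> span_act (m n) y.
Proof.
have [s [c [x step]]] := filt_approx.
exists c => n y yG.
(* Coefficients depend on the remainder reached so far, so they are chosen for every pair of a stage
   and a remainder before the recursion [Y] is set up. *)
have /choice[a aP] : forall z : nat * M, exists b : nat -> R,
    z.2 \in G (n + c + z.1)%N -> (forall l, b l \in m (n + z.1)%N) /\
      z.2 - \sum_(l < s) b l **: x l \in G (n + c + z.1).+1.
  move=> [k z] /=; have [zG|zG] := boolP (z \in G (n + c + k)%N); last first.
    by exists (fun=> 0).
  have [|b [bP bz]] := step (n + c + k)%N z _ zG; first by lia.
  by exists b => _; split=> // l; have := bP l; rewrite addnAC addnK.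
pose Y := fix Y k := if k is k'.+1 then
  Y k' - \sum_(l < s) a (k', Y k') l **: x l else y.
have YG k : Y k \in G (n + c + k)%N.
  by elim: k => [|k IH]; rewrite ?addn0 // addnS; exact: (aP (k, Y k) IH).2.
have am k l : a (k, Y k) l \in m (n + k)%N by exact: (aP (k, Y k) (YG k)).1.
pose u l k := \sum_(j < k) a (nat_of_ord j, Y j) l.
have uE l k : u l k.+1 = u l k + a (k, Y k) l by rewrite /u big_ord_recr.
have YE k : Y k = y - \sum_(l < s) u l k **: x l.
  elim: k => [|k IH] /=.
    by rewrite big1 ?subr0 // => l _; rewrite /u big_ord0 (biadd0l actDl).
  rewrite {1}IH -addrA -opprD -big_split /=; congr (_ - _).
  by apply: eq_bigr => l _; rewrite uE actDl.
have cauchy l i j : (i <= j)%N -> u l j - u l i \in m i.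
  move=> /subnK <-; elim: (j - i)%N => [|k IH]; first by rewrite subrr rpred0.
  rewrite addSn uE addrAC rpredD //; apply: leq_filt mS _ _ _ _ (am _ _); lia.
have [cmpl _ _ _ _] := local.
have /choice[z zP] : forall l, exists z, forall k, z - u l k \in m k.
  by move=> l; have [z [zP _]] := cmpl (u l) (cauchy l); exists z.
have um l k : u l k \in m n.
  by apply: rpred_sum => j _; apply: leq_filt mS _ _ _ _ (am _ _); exact: leq_addr.
have zm l : z l \in m n by rewrite -(subrK (u l n) (z l)) rpredD.
exists s, (fun l => z l), (fun l => x l); split=> [l|]; first exact: zm.
apply: subr0_eq.
(* The error is the remainder [Y k] minus the tails [z l - u l k] applied to the fixed [x l]; both
   parts lie in [G k]. *)
apply: permG.1 => k.
have -> : y - \sum_(l < s) z l **: x l =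
    Y k - \sum_(l < s) (z l - u l k) **: x l.
  rewrite YE -addrA -opprD -big_split /=; congr (_ - _).
  by apply: eq_bigr => l _; rewrite -actDl subrKC.
rewrite rpredB //; first by apply: leq_filt GS _ _ _ _ (YG k); exact: leq_addl.
by apply: rpred_sum => l _; have := sfiltM (zP l k) (sfilt0 G (x l)); rewrite addn0.
Qed.

Lemma span_sub_filt n y : span_act (m n) y -> y \in G n.
Proof.
move=> [s [a [x [am ->]]]]; apply: rpred_sum => l _.
by have := sfiltM (am l) (sfilt0 G (x l)); rewrite addn0.
Qed.

Hypothesis finite_residue : finite_set [set: residue_ring m].
Let q := card_type (residue_ring m).

Lemma card_quot_power_bounds : exists c, forall n,
  finite_set [set: quot_power m M n] /\
  (q ^ hsum G n <= card_type (quot_power m M n) <= q ^ hsum G (n + c))%N.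
Proof.
have [c cP] := filt_sub_span; exists c => n.
pose B := subgroup (@span_act0 _ M (m n)) (@span_actB _ M (m n)).
have BE : [set x | x \in B] = span_act (m n).
  apply/seteqP; split=> x xB.
    exact: (elimT (subgroupP _ _ x) xB).
  exact: (introT (subgroupP _ _ x) xB).
have sB : subgrp [set x | x \in B] by exact: subgrp_zmodClosed.
have sG i : subgrp [set x | x \in G i] by exact: subgrp_zmodClosed.
have [fin1 e1] := index_filt local finite_residue permG n.
have [fin2 e2] := index_filt local finite_residue permG (n + c).
have sub1 : [set x | x \in B] `<=` [set x | x \in G n].
  by rewrite BE => x; exact: span_sub_filt.
have sub2 : [set x | x \in G (n + c)%N] `<=` [set x | x \in B].
  by rewrite BE => x; exact: cP.
have finB := fin_indexl sB (sG _) sub2 fin2.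
have finq : finite_set [set: quot_power m M n] by exact/(quot_finite B).
split=> //; rewrite [card_type _](quot_index finq) -e1 -e2.
apply/andP; split.
  rewrite (index_mulS (@subgrpT M) (sG n) sB sub1 finB).
  apply: leq_pmulr; apply: index_gt0; rewrite ?setTI //.
  by apply: fin_indexS finB.
rewrite (index_mulS (@subgrpT M) sB (sG (n + c)%N) sub2 fin2).
apply: leq_pmulr; apply: index_gt0; rewrite ?setTI //.
by apply: fin_indexS fin2.
Qed.

End Approximation.

(** * The limit *)

(** This gives the lower and upper bounds, at [n] and [n + c], the same limit after division by
    [n^d]. *)
Lemma coef_comp_shift (F : numDomainType) (P : {poly F}) (c : F) d :
  (size P <= d.+1)%N -> (P \Po ('X + c%:P))`_d = P`_d.
Proof.
have s2 : size ('X + c%:P) = 2%N by rewrite size_XaddC.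
have sPc : size (P \Po ('X + c%:P)) = size P by exact: size_comp_poly2.
rewrite leq_eqVlt => /predU1P[sP|sP]; last first.
  by rewrite !nth_default // ?sPc.
have := lead_coef_comp P (q := 'X + c%:P); rewrite s2 => /(_ isT).
rewrite lead_coefE sPc sP /= => ->; rewrite !lead_coefE s2 sP /=.
by rewrite coefD coefX coefC /= addr0 expr1n mulr1.
Qed.

Section Limit.
Variable K : realType.

Lemma poly_seq_cvg (P : {poly rat}) d : (size P <= d.+1)%N ->
  (fun n : nat => ratr P.[n%:R] / n%:R ^+ d : K) @ \oo --> (ratr P`_d : K).
Proof.
move=> sP; pose Q : {poly K} := map_poly ratr P.
have sQ : (size Q <= d.+1)%N by rewrite size_map_poly.
have [C C0 CP] := poly_coef_bound sQ.
apply/cvgrPdist_le => e e0; near=> n.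
have n1 : 1 <= n%:R :> K by rewrite ler1n; near: n; exact: nbhs_infty_ge.
have n0 : 0 < n%:R :> K by exact: lt_le_trans n1.
have nd : 0 < n%:R ^+ d :> K by rewrite exprn_gt0.
have Cn : C / e <= n%:R by near: n; exact: nbhs_infty_ger.
have := CP n%:R n1; rewrite coef_map -(ratr_nat K n) horner_map /= ratr_nat.
move=> CPn; rewrite -(ler_pM2l n0) -(ler_pM2r nd) -mulrA.
rewrite -[X in n%:R * (_ * X)](ger0_norm (ltW nd)) -normrM mulrBl.
rewrite divfK ?gt_eqF // distrC; apply: le_trans CPn _.
by rewrite ler_pM2r // -ler_pdivrMr.
Unshelve. all: by end_near. Qed.

Variables (R : naRingType) (m : ring_filtration R).
Hypothesis local : complete_local_filtered m.
Hypothesis finite_residue : finite_set [set: residue_ring m].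
Variable M : naSpaceType R.

Let q := card_type (residue_ring m).

Definition log_card n : K := ln (card_type (quot_power m M n))%:R / ln q%:R.

Lemma log_card_bounds (G : space_filtration m M) : permissible G ->
  exists c, forall n, (hsum G n)%:R <= log_card n <= (hsum G (n + c))%:R.
Proof.
move=> permG; have [c cP] := card_quot_power_bounds local permG finite_residue.
exists c => n; have [_ /andP[lo hi]] := cP n.
have q1 : 1 < q%:R :> K by rewrite ltr1n; exact: residue_gt1 local finite_residue.
have q0 : 0 < q%:R :> K by exact: lt_trans q1.
have lnq : 0 < ln q%:R :> K by exact: ln_gt0.
have pos k : 0 < (q ^ k)%:R :> K by rewrite natrX exprn_gt0.
have card0 : 0 < (card_type (quot_power m M n))%:R :> K.
  by apply: lt_le_trans (pos _) _; rewrite ler_nat; exact: lo.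
have lnX k : ln (q ^ k)%:R = k%:R * ln q%:R :> K.
  by rewrite natrX lnXn // mulr_natl.
rewrite /log_card ler_pdivlMr // ler_pdivrMr // -!lnX.
by rewrite !ler_ln ?posrE // !ler_nat lo hi.
Qed.

(** [d] only bounds the degree, so that two filtrations can be compared under one normalisation
    before their degrees are known to agree. *)
Lemma log_card_cvg (G : space_filtration m M) d : permissible G ->
  (size (hilbert_samuel G) <= d.+1)%N ->
  (fun n => log_card n / n%:R ^+ d) @ \oo --> (ratr (hilbert_samuel G)`_d : K).
Proof.
move=> permG sP; have [c cP] := log_card_bounds permG.
have [[N PE] _] := hilbert_samuelP local finite_residue permG.
set P := hilbert_samuel G in sP PE *.
pose Q := P \Po ('X + (c%:R)%:P).
have sQ : (size Q <= d.+1)%N by rewrite size_comp_poly2 // size_XaddC.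
have QE n : (N <= n)%N -> Q.[n%:R] = (hsum G (n + c))%:R.
  by move=> Nn; rewrite horner_comp !hornerE -natrD PE // (leq_trans Nn) // leq_addr.
have Pcvg := poly_seq_cvg sP; have Qcvg := poly_seq_cvg sQ.
rewrite (coef_comp_shift _ sP) in Qcvg.
apply: squeeze_cvgr Pcvg Qcvg; near=> n.
have Nn : (N <= n)%N by near: n; exact: nbhs_infty_ge.
have nd : 0 <= (n%:R ^+ d)^-1 :> K by rewrite invr_ge0 exprn_ge0.
by rewrite PE // QE // !ratr_nat !ler_wpM2r //; have /andP[] := cP n.
Unshelve. all: by end_near. Qed.

(** [log_card] does not involve the filtration, so by uniqueness of limits the coefficients of [x^d]
    agree for every [d] bounding both degrees. At the larger degree this forces equal degrees, then
    equal leading coefficients. *)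
Lemma hilbert_samuel_unique (F G : space_filtration m M) :
  permissible F -> permissible G ->
  size (hilbert_samuel F) = size (hilbert_samuel G) /\
  lead_coef (hilbert_samuel F) = lead_coef (hilbert_samuel G).
Proof.
move=> permF permG; set P := hilbert_samuel F; set Q := hilbert_samuel G.
have coefE d : (size P <= d.+1)%N -> (size Q <= d.+1)%N -> P`_d = Q`_d.
  move=> sP sQ; apply: (fmorph_inj (ratr : rat -> K)).
  by apply: cvg_unique (log_card_cvg permF sP) (log_card_cvg permG sQ).
have le (A B : {poly rat}) : (forall d, (size A <= d.+1)%N ->
    (size B <= d.+1)%N -> A`_d = B`_d) -> (size A <= size B)%N.
  move=> AB; rewrite leqNgt; apply/negP => BA.
  have A0 : A != 0 by rewrite -size_poly_gt0; exact: leq_ltn_trans BA.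
  have sA : size A = (size A).-1.+1 by rewrite prednK // size_poly_gt0.
  have := AB (size A).-1; rewrite -sA leqnn (ltnW BA) => /(_ isT isT).
  rewrite [in RHS]nth_default; last by rewrite -ltnS -sA.
  by move/eqP; rewrite -lead_coefE lead_coef_eq0 (negPf A0).
have sPQ : size P = size Q.
  by apply/eqP; rewrite eqn_leq !le // => d sB sA; rewrite coefE.
by split=> //; rewrite !lead_coefE -sPQ coefE // -?sPQ leqSpred.
Qed.

End Limit.

(** [delta] and [alpha] come from two independently chosen permissible filtrations, so independence
    of the dimension from the choice is part of the claim. Finiteness of the quotients is asserted
    because [card_type] is 0 on infinite types. *)
Theorem theorem5p6 (K : realType)
    (R : naRingType) (m : ring_filtration R)
    (R_local : complete_local_filtered m)
    (residue_finite : finite_set [set: residue_ring m])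
    (M : naSpaceType R)
    (F0 : space_filtration m M) (F0_permissible : permissible F0)
    (F : space_filtration m M) (F_permissible : permissible F) :
  let q := card_type (residue_ring m) in
  let delta := krull_dim (gr_space F0) in
  let alpha := lead_coef (hilbert_samuel F) in
  (forall n, finite_set [set: quot_power m M n]) /\
  ((fun n : nat =>
      (ln (card_type (quot_power m M n))%:R / ln q%:R) / n%:R ^ delta : K)
     @ \oo --> (ratr alpha : K)) /\
  (forall G : space_filtration m M, permissible G ->
     (size (hilbert_samuel G))%:Z = delta + 1 /\
     lead_coef (hilbert_samuel G) = alpha).
Proof.
move=> q delta alpha.
have [_ sizeF0] := hilbert_samuelP R_local residue_finite F0_permissible.
have unique := @hilbert_samuel_unique K R m R_local residue_finite M.
have sizeG (G : space_filtration m M) : permissible G ->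
    (size (hilbert_samuel G))%:Z = delta + 1.
  by move=> permG; rewrite (unique G F0 permG F0_permissible).1.
split; last split.
- have [c cP] := card_quot_power_bounds R_local F_permissible residue_finite.
  by move=> n; case: (cP n).
- have sF := sizeG F F_permissible.
  (* The zero polynomial means [delta = -1], a negative exponent to which [log_card_cvg] does not
     apply; the logarithm is then eventually 0, and so is the quotient. *)
  have [P0|P0] := eqVneq (hilbert_samuel F) 0.
    have [c cP] := log_card_bounds K R_local residue_finite F_permissible.
    have [[N PE] _] := hilbert_samuelP R_local residue_finite F_permissible.
    rewrite /alpha P0 lead_coef0 rmorph0; apply: cvg_near_cst; near=> n.
    have Nn : (N <= n)%N by near: n; exact: nbhs_infty_ge.
    have h0 k : (N <= k)%N -> (hsum F k)%:R = 0 :> K.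
      move=> Nk; have := PE k Nk; rewrite P0 horner0 => /esym/eqP.
      by rewrite pnatr_eq0 => /eqP ->.
    have := cP n; rewrite !h0 // ?(leq_trans Nn) ?leq_addr // => le0.
    have log0 : log_card K m M n = 0 by apply/eqP; rewrite eq_le andbC.
    by rewrite -[X in X / _]/(log_card K m M n) log0 mul0r.
  have sP : size (hilbert_samuel F) = (size (hilbert_samuel F)).-1.+1.
    by rewrite prednK // size_poly_gt0.
  have -> : delta = (size (hilbert_samuel F)).-1%:Z by lia.
  rewrite /alpha lead_coefE; apply: log_card_cvg => //.
  by rewrite -sP.
move=> G permG; split; first exact: sizeG.
exact: (unique G F permG F_permissible).2.
Unshelve. all: by end_near. Qed.
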